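(* Let $X$ be a compact well-ordered space whose limit capacity is a successor ordinal. Then the homeomorphism group $\mathrm{Homeo}(X)$, regarded as an abstract group, is SB-generated.
   Context: A well-ordered space is a well-ordered set with its order topology. For a space $X$, set $X^{(0)}=X$, $X^{(\alpha+1)}$ the set of accumulation points of $X^{(\alpha)}$, and $X^{(\lambda)}=\bigcap_{\alpha<\lambda}X^{(\alpha)}$ for limit $\lambda$; the Cantor--Bendixson rank is the least $\alpha$ with $X^{(\alpha+1)}=X^{(\alpha)}$. For a compact well-ordered space this rank is a successor ordinal, and its predecessor is called the limit capacity. A subset of a group $G$ is strongly bounded if it has finite diameter in every left-invariant metric on $G$; a group is SB-generated if generated by a strongly bounded subset. *)

(* Defs.v *)
From HB Require Import structures.
From mathcomp Require Import all_boot all_order all_algebra.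
From mathcomp Require Import all_classical all_reals.
From mathcomp Require Import topology_structure order_topology compact.
From Stdlib Require Import Rdefinitions Raxioms.

Set Implicit Arguments.
Unset Strict Implicit.
Unset Printing Implicit Defensive.

Import Order.TTheory.
Local Open Scope classical_set_scope.
Local Open Scope order_scope.

Definition well_ordered {d} (T : orderType d) : Prop :=
  forall A : set T, A !=set0 -> exists x, A x /\ forall y, A y -> x <= y.

Definition is_succ {d} {W : orderType d} (v w : W) : Prop :=
  v < w /\ forall u, v < u -> w <= u.

Definition is_limit {d} {W : orderType d} (w : W) : Prop :=
  (exists v, v < w) /\ ~ (exists v, is_succ v w).

(** [D] is the Cantor--Bendixson derivative hierarchy of the space [X]
    indexed by (the ordinals represented by) the well-ordered set [W]:
    X^(0) = X, X^(a+1) = accumulation points of X^(a),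
    X^(l) = intersection of X^(a), a < l, for limit l. *)
Definition CB_hierarchy {dW} {W : orderType dW} {X : topologicalType}
    (D : W -> set X) : Prop :=
  [/\ (forall w, (forall v, ~ v < w) -> D w = [set: X]),
      (forall v w, is_succ v w -> D w = limit_point (D v)) &
      (forall w, is_limit w -> D w = \bigcap_(v in [set v | v < w]) D v)].

Definition CB_rank_at {dW} {W : orderType dW} {X : topologicalType}
    (D : W -> set X) (r : W) : Prop :=
  (exists r1, is_succ r r1 /\ D r1 = D r) /\
  (forall a b, is_succ a b -> a < r -> D b <> D a).

(** The limit capacity (the predecessor of the CB rank) of [X] is a
    successor ordinal: the rank is g2 = g1 + 1 with g1 = g0 + 1. *)
Definition limit_capacity_is_successor (X : topologicalType) : Prop :=
  exists dW (W : orderType dW) (D : W -> set X) (g0 g1 g2 : W),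
    [/\ well_ordered W, CB_hierarchy D, is_succ g0 g1, is_succ g1 g2
      & CB_rank_at D g2].

Definition is_homeo {X : topologicalType} (f : X -> X) : Prop :=
  exists g : X -> X, [/\ cancel f g, cancel g f, continuous f & continuous g].

Definition Homeo (X : topologicalType) : set (X -> X) := [set f | is_homeo f].
Arguments Homeo X : clear implicits.

Definition left_invariant_metric {X : topologicalType}
    (dist : (X -> X) -> (X -> X) -> R) : Prop :=
  let G := Homeo X in
  [/\ (forall f, G f -> dist f f = 0%R),
      (forall f g, G f -> G g -> dist f g = 0%R -> f = g),
      (forall f g, G f -> G g -> dist f g = dist g f),
      (forall f g h, G f -> G g -> G h -> Rle (dist f h) (Rplus (dist f g) (dist g h)))
    & (forall f g h, G f -> G g -> G h -> dist (h \o f) (h \o g) = dist f g)].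

Definition strongly_bounded {X : topologicalType} (S : set (X -> X)) : Prop :=
  S `<=` Homeo X /\
  forall dist : (X -> X) -> (X -> X) -> R, left_invariant_metric dist ->
    exists M : R, forall f g, S f -> S g -> Rle (dist f g) M.

Definition generates_Homeo {X : topologicalType} (S : set (X -> X)) : Prop :=
  forall g, Homeo X g ->
    exists s : seq (X -> X),
      (forall h, h \in s -> S h \/ exists k, [/\ S k, cancel k h & cancel h k]) /\
      g = foldr (fun h acc => h \o acc) id s.

Definition SB_generated_Homeo (X : topologicalType) : Prop :=
  exists S : set (X -> X), strongly_bounded S /\ generates_Homeo S.
Arguments limit_capacity_is_successor X : clear implicits.
Arguments SB_generated_Homeo X : clear implicits.

(* Main.v *)
Require Import Defs.
From Stdlib Require Import Rdefinitions Raxioms RIneq Rfunctions.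
From mathcomp Require Import all_boot all_order interval all_classical.
From mathcomp Require Import topology_structure separation_axioms subspace_topology.
From mathcomp Require Import order_topology compact.

(** Let [T] be the last nonempty Cantor-Bendixson derivative of [X], a finite set, and [Z] the
    derivative before it, so that [T] is the set of limit points of [Z]. Cut [X] into clopen
    sectors, one around each [p] in [T]. Comparing well-orders shows that a clopen set with exactly
    one point of [Z] is determined up to homeomorphism, and so is every relatively clopen subset
    of a punctured sector with infinitely many points of [Z]. Hence a punctured sector splits into
    infinitely many copies of itself, and Bergman's argument bounds the homeomorphism group of
    a sector in every left-invariant metric. The homeomorphisms preserving all sectors therefore
    form a strongly bounded set. Together with finitely many maps they generate the whole group:
    swaps of two sectors, which realize the permutations of [T], and for each [p] a shift carrying
    one point of [Z] from the sector of [p] to that of a fixed base point. *)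

Set Implicit Arguments.
Unset Strict Implicit.
Unset Printing Implicit Defensive.

Import Order.TTheory.
Local Open Scope order_scope.
Local Open Scope classical_set_scope.

(** The obstacle is that comparing well-orders only gives an isomorphism onto an initial segment. An
    invariant decides where the segment ends: homeomorphisms between open sets send points of [Z] to
    points of [Z]. A punctured sector has infinitely many points of [Z], but finitely many below
    each of its points, so a copy of it cannot stop early. Sets are compared after adding the
    puncture [p], which makes them closed, and closedness is what turns order isomorphisms into
    continuous maps; compactness of [X] extends homeomorphisms of punctured sets over the punctures.
    The original order may continue beyond the last point of [T], where no sector would reach, hence
    the change of order. The successor assumption supplies [Z]: each [p] is approached by a sequence
    of cells, any infinite part of which looks like the whole. *)

(** * Homeomorphisms between open subsets *)

Section PartialHomeo.
Variable X : topologicalType.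
Implicit Types (A B C : set X) (f g : X -> X) (x y : X).

(** Total functions constrained on [A] and [B] only, to avoid subtypes. As both sets are open,
    continuity in [X] at their points is continuity of the restrictions. *)
Record phomeo A B f g : Prop := PHomeo {
  ph_openl : open A;
  ph_openr : open B;
  ph_fun : forall x, A x -> B (f x);
  ph_inv : forall y, B y -> A (g y);
  ph_funK : forall x, A x -> g (f x) = x;
  ph_invK : forall y, B y -> f (g y) = y;
  ph_cfun : forall x, A x -> {for x, continuous f};
  ph_cinv : forall y, B y -> {for y, continuous g} }.

Definition homeomorphic A B := exists f g, phomeo A B f g.

Lemma continuous_at_eq A f f' x : open A -> A x -> (forall y, A y -> f y = f' y) ->
  {for x, continuous f} -> {for x, continuous f'}.
Proof.
move=> oA Ax ff' cf U; rewrite /= -ff'// => /cf fU.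
have AN : nbhs x A by exact: open_nbhs_nbhs.
by apply: filterS2 AN fU => y Ay /= Uy; rewrite /= -ff'.
Qed.

Lemma phomeo_id A : open A -> phomeo A A id id.
Proof. by move=> oA; split => //= x Ax U. Qed.

Lemma phomeo_sym A B f g : phomeo A B f g -> phomeo B A g f.
Proof. by case; split. Qed.

Lemma continuous_at_comp f g x : {for x, continuous f} -> {for f x, continuous g} ->
  {for x, continuous (g \o f)}.
Proof. by move=> cf cg; exact: continuous_comp. Qed.

Lemma phomeo_comp A B C f g f' g' : phomeo A B f g -> phomeo B C f' g' ->
  phomeo A C (f' \o f) (g \o g').
Proof.
move=> [oA oB fA gB fK gK cf cg] [_ oC fB gC fK' gK' cf' cg'].
split=> //= x xA; rewrite ?fK' ?gK ?fK ?gK'; auto.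
- by apply: continuous_at_comp; auto.
- by apply: continuous_at_comp; auto.
Qed.

Lemma phomeo_bigcup (I : Type) (A B : I -> set X) (f g : I -> X -> X) :
  (forall i j x, A i x -> A j x -> i = j) ->
  (forall i j x, B i x -> B j x -> i = j) ->
  (forall i, phomeo (A i) (B i) (f i) (g i)) ->
  exists f' g', [/\ phomeo (\bigcup_i A i) (\bigcup_i B i) f' g',
    forall i x, A i x -> f' x = f i x & forall i x, B i x -> g' x = g i x].
Proof.
move=> dA dB ph.
pose glue (D : I -> set X) (h : I -> X -> X) x :=
  if pselect (exists i, D i x) is left e then h (projT1 (cid e)) x else x.
have glueE D h : (forall i j x, D i x -> D j x -> i = j) ->
    forall i x, D i x -> glue D h x = h i x.
  move=> dD i x Dix; rewrite /glue; case: pselect => [e|[]]; last by exists i.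
  by case: cid => j /= Djx; rewrite (dD _ _ _ Djx Dix).
exists (glue A f), (glue B g); split; [|exact: glueE|exact: glueE].
split.
- by apply: bigcup_open => i _; exact: ph_openl (ph i).
- by apply: bigcup_open => i _; exact: ph_openr (ph i).
- by move=> x [i _ Ax]; exists i => //; rewrite (glueE _ _ dA i)//; apply: ph_fun (ph i) _ _.
- by move=> x [i _ Bx]; exists i => //; rewrite (glueE _ _ dB i)//; apply: ph_inv (ph i) _ _.
- move=> x [i _ Ax]; rewrite (glueE _ _ dA i)// (glueE _ _ dB i).
    exact: ph_funK (ph i) _ Ax.
  exact: ph_fun (ph i) _ _.
- move=> x [i _ Bx]; rewrite (glueE _ _ dB i)// (glueE _ _ dA i).
    exact: ph_invK (ph i) _ Bx.
  exact: ph_inv (ph i) _ _.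
- move=> x [i _ Ax]; apply: (@continuous_at_eq (A i) (f i)) => //.
  + exact: ph_openl (ph i).
  + by move=> y Ay; rewrite (glueE _ _ dA i).
  + exact: ph_cfun (ph i) _ Ax.
- move=> x [i _ Bx]; apply: (@continuous_at_eq (B i) (g i)) => //.
  + exact: ph_openr (ph i).
  + by move=> y By; rewrite (glueE _ _ dB i).
  + exact: ph_cinv (ph i) _ Bx.
Qed.

Lemma phomeo_setU A1 A2 B1 B2 f1 g1 f2 g2 :
  phomeo A1 B1 f1 g1 -> phomeo A2 B2 f2 g2 ->
  (forall x, A1 x -> A2 x -> False) -> (forall x, B1 x -> B2 x -> False) ->
  exists f g, [/\ phomeo (A1 `|` A2) (B1 `|` B2) f g,
    forall x, A1 x -> f x = f1 x & forall x, A2 x -> f x = f2 x].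
Proof.
move=> p1 p2 dA dB.
have [| | |f [g [p fE _]]] := @phomeo_bigcup bool (fun b => if b then A1 else A2)
   (fun b => if b then B1 else B2) (fun b => if b then f1 else f2) (fun b => if b then g1 else g2).
- by case=> [] [] x // a b; case: (dA x).
- by case=> [] [] x // a b; case: (dB x).
- by case.
exists f, g; split; [|by move=> x; exact: (fE true)|by move=> x; exact: (fE false)].
have E (D1 D2 : set X) : \bigcup_(b in [set: bool]) (if b then D1 else D2) = D1 `|` D2.
  apply/seteqP; split=> x /=; first by case=> -[]; [left|right].
  by case=> ?; [exists true|exists false].
by rewrite -!E.
Qed.

Lemma homeomorphic_refl A : open A -> homeomorphic A A.
Proof. by move=> oA; exists id, id; exact: phomeo_id. Qed.

Lemma homeomorphic_sym A B : homeomorphic A B -> homeomorphic B A.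
Proof. by move=> [f [g p]]; exists g, f; exact: phomeo_sym. Qed.

Lemma homeomorphic_trans A B C : homeomorphic A B -> homeomorphic B C -> homeomorphic A C.
Proof. by move=> [f [g p]] [f' [g' p']]; exists (f' \o f), (g \o g'); exact: phomeo_comp p'. Qed.

Lemma homeomorphic_setU A1 A2 B1 B2 : homeomorphic A1 B1 -> homeomorphic A2 B2 ->
  (forall x, A1 x -> A2 x -> False) -> (forall x, B1 x -> B2 x -> False) ->
  homeomorphic (A1 `|` A2) (B1 `|` B2).
Proof.
move=> [f1 [g1 p1]] [f2 [g2 p2]] dA dB.
by have [f [g [p _ _]]] := phomeo_setU p1 p2 dA dB; exists f, g.
Qed.

(* In a compact Hausdorff space, a homeomorphism between punctured clopen sets
   extends over the punctures: the clopen sets are one-point compactifications. *)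
Lemma phomeo_fill A B p q f g : hausdorff_space X -> compact [set: X] ->
  clopen A -> clopen B -> A p -> B q ->
  phomeo (A `\ p) (B `\ q) f g ->
  exists f' g', [/\ phomeo A B f' g', f' p = q & forall x, x <> p -> f' x = f x].
Proof.
move=> hX cX cA cB Ap Bq ph.
pose ext (h : X -> X) a b x := if pselect (x = a) then b else h x.
have extE h a b : ext h a b a = b by rewrite /ext; case: pselect.
have extN h a b x : x <> a -> ext h a b x = h x by rewrite /ext; case: pselect.
have cont (C D : set X) a b h k : clopen C -> clopen D -> C a -> D b ->
    phomeo (C `\ a) (D `\ b) h k -> forall x, C x -> {for x, continuous (ext h a b)}.
  move=> [oC cC] [oD cD] Ca Db pk x Cx.
  have [->|xa] := pselect (x = a); last first.
    apply: (@continuous_at_eq (C `\ a) h); first exact: ph_openl pk.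
    + by split=> // /=.
    + by move=> y [_ /= ya]; rewrite extN.
    + by apply: ph_cfun pk _ _; split.
  move=> U; rewrite /= extE => nU.
  (* [K] is compact and misses [b], so its image under [k] is closed and misses [a]; the rest of [C]
     is the required neighbourhood of [a]. *)
  pose K := D `&` ~` (interior U).
  have sK : K `<=` D `\ b.
    by move=> y [Dy nUy]; split=> // /= yb; apply: nUy; rewrite yb; exact: nU.
  have cK : compact K.
    apply: (subclosed_compact _ cX) => //; apply: closedI => //.
    exact/open_closedC/open_interior.
  have ck : compact (k @` K).
    apply: continuous_compact => //.
    apply: continuous_in_subspaceT => y; rewrite inE => Ky.
    exact: ph_cinv pk _ (sK _ Ky).
  have clk := compact_closed hX ck.
  have oN : open (C `&` ~` (k @` K)) by apply: openI => //; exact: closed_openC.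
  have aN : (C `&` ~` (k @` K)) a.
    split=> // -[y /sK Dy ka]; have := ph_inv pk Dy.
    by rewrite ka => -[_]; apply.
  apply: filterS (open_nbhs_nbhs (conj oN aN)) => y [Cy nky].
  have [->|ya] := pselect (y = a).
    by rewrite /preimage /= extE; exact: nbhs_singleton.
  rewrite /preimage /= extN //.
  have Chy : (C `\ a) y by split.
  have [Dhy _] := ph_fun pk Chy.
  have [//|nU'] := pselect (U (h y)).
  exfalso; apply: nky; exists (h y); last exact: ph_funK pk _ Chy.
  by split=> // /(@interior_subset X); exact: nU'.
exists (ext f p q), (ext g q p); split; [|exact: extE|by move=> x; exact: extN].
split.
- by case: cA.
- by case: cB.
- move=> x Ax; have [->|xp] := pselect (x = p); first by rewrite extE.
  by rewrite extN//; have [] : (B `\ q) (f x) by apply: (ph_fun ph); split.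
- move=> x Ax; have [->|xp] := pselect (x = q); first by rewrite extE.
  by rewrite extN//; have [] : (A `\ p) (g x) by apply: (ph_inv ph); split.
- move=> x Ax; have [->|xp] := pselect (x = p); first by rewrite !extE.
  have Ax' : (A `\ p) x by split.
  by rewrite (extN f)// extN; [exact: (ph_funK ph)|have [] := ph_fun ph Ax'].
- move=> x Ax; have [->|xp] := pselect (x = q); first by rewrite !extE.
  have Ax' : (B `\ q) x by split.
  by rewrite (extN g)// extN; [exact: (ph_invK ph)|have [] := ph_inv ph Ax'].
- exact: (cont A B p q f g).
- by apply: (cont B A q p g f) => //; exact: phomeo_sym.
Qed.

Record haut := HAut {
  hfun :> X -> X;
  hinv : X -> X;
  hfunK : cancel hfun hinv;
  hinvK : cancel hinv hfun;
  hcfun : continuous hfun;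
  hcinv : continuous hinv }.

Lemma haut_eq (h k : haut) : h =1 k -> h = k.
Proof.
case: h k => [f g fK gK cf cg] [f' g' fK' gK' cf' cg'] /= /funext E.
have E' : g = g' by apply/funext => x; rewrite -{1}(gK' x) -E fK.
by subst f' g'; congr HAut; exact: Prop_irrelevance.
Qed.

Definition haut1 : haut := @HAut id id (fun=> erefl) (fun=> erefl) (fun _ _ => id) (fun _ _ => id).
Definition hautV (h : haut) : haut := HAut (@hinvK h) (@hfunK h) (@hcinv h) (@hcfun h).
Definition hautM (h k : haut) : haut :=
  HAut (can_comp (@hfunK h) (@hfunK k)) (can_comp (@hinvK k) (@hinvK h))
    (fun x => continuous_at_comp (@hcfun k x) (@hcfun h _))
    (fun x => continuous_at_comp (@hcinv h x) (@hcinv k _)).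

Lemma haut_phomeo (h : haut) A : open A -> phomeo A (hinv h @^-1` A) h (hinv h).
Proof.
move=> oA; split=> //.
- by apply: open_comp => // x _; exact: hcinv.
- by move=> x; rewrite /preimage/= hfunK.
- by move=> x _; rewrite hfunK.
- by move=> x _; rewrite hinvK.
- by move=> x _; exact: hcfun.
- by move=> x _; exact: hcinv.
Qed.

Lemma haut_of_phomeo f g : phomeo [set: X] [set: X] f g -> exists h : haut, h = f :> (X -> X).
Proof.
case=> _ _ _ _ fK gK cf cg.
have fK' : cancel f g by move=> x; exact: fK.
have gK' : cancel g f by move=> x; exact: gK.
by exists (HAut fK' gK' (fun x => @cf x I) (fun x => @cg x I)).
Qed.

Lemma haut_extend A B f g f' g' : phomeo A B f g -> phomeo (~` A) (~` B) f' g' ->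
  exists h : haut, (forall x, A x -> h x = f x) /\ (forall x, ~ A x -> h x = f' x).
Proof.
move=> p1 p2; have [//|//|h [k [p hf hf']]] := phomeo_setU p1 p2.
move: p; rewrite !setUCr => /haut_of_phomeo[H HE].
by exists H; rewrite HE.
Qed.

Lemma haut_extend_id A f g : clopen A -> phomeo A A f g ->
  exists h : haut, (forall x, A x -> h x = f x) /\ (forall x, ~ A x -> h x = x).
Proof.
move=> [oA cA] p; apply: (haut_extend p); apply: phomeo_id.
exact: closed_openC.
Qed.

End PartialHomeo.

(* A well-order on the points of a space, transported from [W] along [rk], whose order
   topology is the given one. The detour through [rk] permits to change the order of a space
   without changing its type. *)
Record wo_space (X : topologicalType) d (W : orderType d) (rk : X -> W) : Prop := WOSpace {
  rk_inj : injective rk;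
  rk_min : forall A : set X, A !=set0 -> exists2 x, A x & forall y, A y -> rk x <= rk y;
  rk_le_open : forall x, open [set y | rk y <= rk x];
  rk_gt_open : forall x, open [set y | rk x < rk y];
  rk_nbhs : forall x U, nbhs x U ->
    (exists2 y, rk y < rk x & forall z, rk y < rk z -> rk z <= rk x -> U z) \/
    (forall z, rk z <= rk x -> U z) }.

(** * Comparison of well-orders, and continuity of order isomorphisms *)

Section WellOrderedSpace.
Variables (X : topologicalType) (d : Order.disp_t) (W : orderType d) (rk : X -> W).
Hypothesis wo : wo_space rk.
Implicit Types (A B C F : set X) (f g : X -> X) (x y : X).

Lemma rk_le_clopen x : clopen [set y | rk y <= rk x].
Proof.
split; first exact: rk_le_open wo x.
have -> : [set y | rk y <= rk x] = ~` [set y | rk x < rk y].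
  by apply/seteqP; split=> y /=; rewrite leNgt => /negP.
exact/open_closedC/(rk_gt_open wo).
Qed.

Lemma rk_gt_clopen x : clopen [set y | rk x < rk y].
Proof.
have -> : [set y | rk x < rk y] = ~` [set y | rk y <= rk x].
  by apply/seteqP; split=> y /=; rewrite ltNge => /negP.
have [o c] := rk_le_clopen x.
by split; [exact: closed_openC|exact: open_closedC].
Qed.

Lemma wo_hausdorff : hausdorff_space X.
Proof.
rewrite open_hausdorff => x y.
wlog lt : x y / rk x < rk y => [hw xy|_].
  have : rk x != rk y by apply: contra_neq xy => /(rk_inj wo).
  rewrite neq_lt => /orP[/hw|/hw]; first exact.
  move=> /(_ _)[|[A B] /= [? ?] [? ? AB]]; first by rewrite eq_sym.
  by exists (B, A) => //=; split=> //; rewrite setIC.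
exists ([set z | rk z <= rk x], [set z | rk x < rk z]) => /=; first by rewrite !inE/= lexx lt.
split; [exact: rk_le_open wo x|exact: rk_gt_open wo x|].
by apply/eqP/seteqP; split=> // z /= [] /le_lt_trans/[apply]; rewrite ltxx.
Qed.

Lemma wf_rk : well_founded (fun x y => rk x < rk y).
Proof.
move=> x; apply: contrapT => nx.
have [|m nm lm] := rk_min wo (A := [set x | ~ Acc (fun x y => rk x < rk y) x]).
  by exists x.
apply: nm; apply: Acc_intro => y ym; apply: contrapT => /lm.
by rewrite leNgt ym.
Qed.

(** If the least upper bound [m] were outside [F], a left neighbourhood of [m] free of [F] would
    give a smaller bound. *)
Lemma closed_max F x : closed F -> F x -> (exists y, forall z, F z -> rk z <= rk y) ->
  exists2 m, F m & forall z, F z -> rk z <= rk m.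
Proof.
move=> cF Fx bF; have [m mF lm] := rk_min wo bF.
exists m => //; rewrite -[F]setCK; apply: contrapT => nFm.
have : nbhs m (~` F) by apply: open_nbhs_nbhs; split; [exact: closed_openC|exact: contrapT].
case/(rk_nbhs wo) => [[y ym yF]|mN]; last exact: mN _ (mF _ Fx) Fx.
have : ~ (forall z, F z -> rk z <= rk y) by move/lm; rewrite leNgt ym.
apply => z Fz; rewrite leNgt; apply/negP => yz.
exact: yF _ yz (mF _ Fz) Fz.
Qed.

(** The least [m] with infinitely many points of [A] at or below it would be a limit point of [A]: a
    left neighbourhood of [m] omits only finitely many of these points. *)
Lemma finite_below A y : (forall x, rk x <= rk y -> ~ limit_point A x) ->
  finite_set (A `&` [set x | rk x <= rk y]).
Proof.
move=> nlim; apply: contrapT => inf.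
pose P x := rk x <= rk y /\ ~ finite_set (A `&` [set z | rk z <= rk x]).
have [|m [my infm] lm] := rk_min wo (A := [set x | P x]).
  by exists y; split.
apply: infm; have := nlim _ my; rewrite not_limit_pointE => -[U nU UA].
have AU z : A z -> U z -> z = m.
  by move=> Az Uz; apply: UA.
case: (rk_nbhs wo nU) => [[x xm xU]|mU].
  have [fx|nfx] := pselect (finite_set (A `&` [set z | rk z <= rk x])); last first.
    have : P x by split=> //; exact: le_trans (ltW xm) my.
    by move/lm; rewrite leNgt xm.
  apply: (@sub_finite_set _ _ ((A `&` [set z | rk z <= rk x]) `|` [set m])).
    move=> z [Az /= zm]; have [zx|xz] := leP (rk z) (rk x); first by left.
    by right; apply: AU => //; exact: xU.
  by rewrite finite_setU; split=> //; exact: finite_set1.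
apply: (@sub_finite_set _ _ [set m]); last exact: finite_set1.
by move=> z [Az /= zm]; apply: AU => //; exact: mU.
Qed.

Definition order_iso F F' f g :=
  [/\ forall x, F x -> F' (f x), forall y, F' y -> F (g y),
      forall x, F x -> g (f x) = x, forall y, F' y -> f (g y) = y &
      forall x y, F x -> F y -> rk x < rk y -> rk (f x) < rk (f y)].

Lemma order_iso_mono F F' f g : order_iso F F' f g -> forall x y, F x -> F y ->
  (rk (f x) <= rk (f y)) = (rk x <= rk y).
Proof.
move=> [fF gF fK gK mf] x y Fx Fy; apply/idP/idP; last first.
  by rewrite le_eqVlt => /orP[/eqP/(rk_inj wo)->//|/mf]; move=> /(_ Fx Fy)/ltW.
by apply: contraTT; rewrite -!ltNge; exact: (mf _ _ Fy Fx).
Qed.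

Lemma order_iso_sym F F' f g : order_iso F F' f g -> order_iso F' F g f.
Proof.
move=> iso; have [fF gF fK gK mf] := iso; split=> // x y F'x F'y.
by rewrite !ltNge -(order_iso_mono iso (gF _ F'y) (gF _ F'x)) !gK.
Qed.

(** Order isomorphisms preserve suprema taken inside [F] and [F']; those in [F'] are limits in [X]
    because [F'] is closed. The open set [O] makes neighbourhoods within [F] neighbourhoods in
    [X]. *)
Lemma order_iso_continuous F F' f g O x : closed F' -> order_iso F F' f g ->
  open O -> O `<=` F -> O x -> {for x, continuous f}.
Proof.
move=> cF' iso oO sO Ox U /= nU; have [fF gF fK gK mf] := iso.
have mono := order_iso_mono iso.
have Fx := sO _ Ox; have F'fx := fF _ Fx.
suff [B [oB Bx BU]] : exists B, [/\ open B, B x &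
    forall u, F u -> rk u <= rk x -> B u -> U (f u)].
  have oN : open (O `&` B `&` [set u | rk u <= rk x]).
    by apply: openI; [exact: openI|exact: rk_le_open wo x].
  apply: filterS (open_nbhs_nbhs (conj oN _)); last by split=> //=.
  by move=> u [[Ou Bu] ux]; apply: BU => //; exact: sO.
case: (rk_nbhs wo nU) => [[y yfx yU]|fxU]; last first.
  by exists setT; split=> //; [exact: openT|] => u Fu ux _; apply: fxU; rewrite mono.
have [|v [F'v yv] lv] := rk_min wo (A := [set v | F' v /\ rk y < rk v]).
  by exists (f x).
have vfx : rk v <= rk (f x) by apply: lv.
have Fgv := gF _ F'v.
move: (vfx); rewrite -(gK _ F'v) mono// le_eqVlt => /orP[/eqP/(rk_inj wo) gvx|gvx]; last first.
  exists [set u | rk (g v) < rk u]; split=> //; first exact: rk_gt_open wo (g v).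
  move=> u Fu ux /= gvu; apply: yU; last by rewrite mono.
  by apply: (lt_trans yv); rewrite -(gK _ F'v) mf.
(* [f x] is isolated from the left in [F'], so [x] is isolated from the left in [F]: otherwise
   the supremum of [f u], [F u], [u < x], would be a point of [F'] without preimage. *)
have {}gvx : v = f x by rewrite -gvx gK.
have [[x' [x'x nx']]|nx'] := pselect (exists x', rk x' < rk x /\
    forall u, F u -> rk u < rk x -> rk u <= rk x').
  exists [set u | rk x' < rk u]; split=> //; first exact: rk_gt_open wo x'.
  move=> u Fu; rewrite le_eqVlt => /orP[/eqP/(rk_inj wo)-> _|ux /=].
    exact: nbhs_singleton.
  by move=> x'u; have := nx' _ Fu ux; rewrite leNgt x'u.
have nx u : rk u < rk x -> exists2 w, F w & rk u < rk w < rk x.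
  move=> ux; apply: contrapT => nw; apply: nx'; exists u; split=> // w Fw wx.
  by rewrite leNgt; apply/negP => uw; apply: nw; exists w => //; rewrite uw.
have [[u0 [Fu0 u0x]]|nu0] := pselect (exists u0, F u0 /\ rk u0 < rk x); last first.
  exists setT; split=> //; [exact: openT|] => u Fu; rewrite le_eqVlt => /orP[/eqP/(rk_inj wo)-> _|ux].
    exact: nbhs_singleton.
  by case: nu0; exists u.
have ub u : F u -> rk u < rk x -> rk (f u) <= rk y.
  move=> Fu ux; rewrite leNgt; apply/negP => yu.
  have : rk v <= rk (f u) by apply: lv; split=> //; exact: fF.
  by rewrite gvx mono// leNgt ux.
have [|s sub ls] := rk_min wo (A := [set s | forall u, F u -> rk u < rk x -> rk (f u) <= rk s]).
  by exists y.
have F's : F' s.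
  apply: contrapT => nF's.
  have : nbhs s (~` F') by apply: open_nbhs_nbhs; split=> //; exact: closed_openC.
  case/(rk_nbhs wo) => [[w ws wN]|sN]; last exact: sN _ (sub _ Fu0 u0x) (fF _ Fu0).
  suff : rk s <= rk w by rewrite leNgt ws.
  apply: ls => u Fu ux; rewrite leNgt; apply/negP => wu.
  exact: wN _ wu (sub _ Fu ux) (fF _ Fu).
have Fgs := gF _ F's.
have gsx : rk (g s) < rk x.
  have : rk (f (g s)) < rk (f x) by rewrite gK//; apply: le_lt_trans (ls y ub) yfx.
  by rewrite !ltNge mono.
have [w Fw /andP[gsw wx]] := nx _ gsx.
by have := sub _ Fw wx; rewrite -{1}(gK _ F's) mono// leNgt gsw.
Qed.

Lemma order_iso_phomeo F F' f g O O' : closed F -> closed F' -> order_iso F F' f g ->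
  open O -> open O' -> O `<=` F -> O' `<=` F' ->
  (forall x, O x -> O' (f x)) -> (forall y, O' y -> O (g y)) -> phomeo O O' f g.
Proof.
move=> cF cF' iso oO oO' sO sO' fO gO; have [fF gF fK gK mf] := iso.
split=> //; [by move=> x /sO/fK|by move=> x /sO'/gK| |].
- by move=> x; exact: (@order_iso_continuous F F' f g).
- by move=> x; apply: (@order_iso_continuous F' F g f) => //; exact: order_iso_sym.
Qed.

Definition initial_emb F F' f :=
  [/\ forall x, F x -> F' (f x),
      forall x y, F x -> F y -> rk x < rk y -> rk (f x) < rk (f y) &
      forall x y, F x -> F' y -> rk y < rk (f x) -> exists2 x', F x' & f x' = y].

(** Transfinite recursion: each point goes to the least element of [F'] above all earlier values. If
    this first gets stuck at [m], the values before [m] exhaust [F'], and their inverse embeds [F']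
    onto an initial segment of [F]. *)
Lemma initial_emb_total F F' : (exists f, initial_emb F F' f) \/ (exists f, initial_emb F' F f).
Proof.
pose above x (rec : forall x', rk x' < rk x -> X) : set X :=
  [set y | F' y /\ forall x' (h : rk x' < rk x), F x' -> rk (rec x' h) < rk y].
pose least A : set X := [set y | A y /\ forall z, A z -> rk y <= rk z].
pose body x rec := xget x (least (above x rec)).
pose f := Fix wf_rk (fun=> X) body.
have fE x : f x = xget x (least (above x (fun y _ => f y))).
  rewrite /f Fix_eq// => z h h' hh'; congr body.
  by apply/functional_extensionality_dep => y; apply/functional_extensionality_dep.
pose ab x := above x (fun y _ => f y).
have fP x : ab x !=set0 -> least (ab x) (f x).
  move=> [y aby]; rewrite fE; case: xgetP => // nl.
  have [|m abm lm] := rk_min wo (A := ab x); first by exists y.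
  by case: (nl m).
(* [Q] is a downward closed domain on which the recursion succeeds: everything, or the points before
   [m]. *)
have key (Q : set X) : (forall x x', Q x -> F x' -> rk x' < rk x -> Q x') ->
    (forall x, Q x -> F x -> ab x !=set0) -> initial_emb (F `&` Q) F' f.
  move=> Qd Qab; split.
  - by move=> x [Fx Qx]; have [[]] := fP _ (Qab _ Qx Fx).
  - by move=> x y [Fx _] [Fy Qy] xy; have [[_ H] _] := fP _ (Qab _ Qy Fy); exact: H.
  - elim/(well_founded_ind wf_rk) => x IH y [Fx Qx] F'y yfx.
    have [_ lx] := fP _ (Qab _ Qx Fx).
    have [[x' [Fx' x'x yx']]|nx'] := pselect (exists x', [/\ F x', rk x' < rk x & rk y <= rk (f x')]).
      have Qx' := Qd _ _ Qx Fx' x'x.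
      move: yx'; rewrite le_eqVlt => /orP[/eqP/(rk_inj wo) ->|]; first by exists x'.
      exact: IH.
    suff /lx : ab x y by rewrite leNgt yfx.
    split=> // x' x'x Fx'; rewrite ltNge; apply/negP => yx'; apply: nx'.
    by exists x'.
have [all|nall] := pselect (forall x, F x -> ab x !=set0).
  by left; exists f; rewrite -(setIT F); apply: key => // x _; exact: all.
right.
have [|m [Fm nm] lm] := rk_min wo (A := [set x | F x /\ ~ (ab x !=set0)]).
  apply: contrapT => ne; apply: nall => x Fx; apply: contrapT => nx.
  by apply: ne; exists x.
have [fF mf fi] : initial_emb (F `&` [set x | rk x < rk m]) F' f.
  apply: key => [x x' /= xm _ /lt_trans|x /= xm Fx]; first exact.
  apply: contrapT => nx; suff : rk m <= rk x by rewrite leNgt xm.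
  exact: lm.
have surj y : F' y -> exists x, (F `&` [set x | rk x < rk m]) x /\ f x = y.
  move=> F'y; have [x [Fx xm yx]] : exists x, [/\ F x, rk x < rk m & rk y <= rk (f x)].
    apply: contrapT => nx; apply: nm; exists y; split=> // x xm Fx.
    by rewrite ltNge; apply/negP => yx; apply: nx; exists x.
  move: yx; rewrite le_eqVlt => /orP[/eqP/(rk_inj wo) ->|]; first by exists x.
  by case/fi => // x' ? ?; exists x'.
pose g y := xget y [set x | (F `&` [set x | rk x < rk m]) x /\ f x = y].
have gP y : F' y -> (F `&` [set x | rk x < rk m]) (g y) /\ f (g y) = y.
  by move=> /surj[x xP]; rewrite /g; case: xgetP => // /(_ x).
have mono x x' : (F `&` [set x | rk x < rk m]) x -> (F `&` [set x | rk x < rk m]) x' ->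
    rk (f x) < rk (f x') -> rk x < rk x'.
  move=> Qx Qx'; apply: contraTT; rewrite -!leNgt le_eqVlt => /orP[/eqP/(rk_inj wo)->//|].
  by move/(mf _ _ Qx' Qx)/ltW.
exists g; split.
- by move=> y /gP[[]].
- by move=> y y' /gP[Qy {1}<-] /gP[Qy' {1}<-]; exact: mono.
- move=> y x F'y Fx xgy; have [[_ gym] _] := gP _ F'y.
  have Qx : (F `&` [set x | rk x < rk m]) x by split=> //=; exact: lt_trans gym.
  exists (f x); first exact: fF.
  have [Qg fg] := gP _ (fF _ Qx).
  apply: (rk_inj wo); apply/eqP; rewrite eq_le !leNgt; apply/andP; split; apply/negP.
    by move/(mf _ _ Qx Qg); rewrite fg ltxx.
  by move/(mf _ _ Qg Qx); rewrite fg ltxx.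
Qed.

(** A maximum [m] of [F] makes the initial segment end at [f m], so that a clopen ray cuts it out of
    [F']. *)
Lemma initial_emb_iso F F' f m : initial_emb F F' f -> F m -> (forall x, F x -> rk x <= rk m) ->
  exists g, F' (f m) /\ order_iso F (F' `&` [set y | rk y <= rk (f m)]) f g.
Proof.
move=> [fF mf fi] Fm mm.
pose g y := xget y [set x | F x /\ f x = y].
have finj x x' : F x -> F x' -> f x = f x' -> x = x'.
  move=> Fx Fx' E; apply: (rk_inj wo); apply/eqP; rewrite eq_le !leNgt.
  by apply/andP; split; apply/negP => /mf; rewrite E ltxx => /(_ _ _)/notF; apply.
have gP y : F' y -> rk y <= rk (f m) -> F (g y) /\ f (g y) = y.
  move=> F'y; have : forall x, F x /\ f x = y -> F (g y) /\ f (g y) = y.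
    by move=> x xP; rewrite /g; case: xgetP => // /(_ x).
  move=> H; rewrite le_eqVlt => /orP[/eqP/(rk_inj wo) E|]; first by apply: (H m); rewrite E.
  by case/fi => // x Fx fx; apply: (H x).
have mle x : F x -> rk (f x) <= rk (f m).
  move=> Fx; have := mm _ Fx; rewrite le_eqVlt => /orP[/eqP/(rk_inj wo)->//|/mf].
  by move=> /(_ Fx Fm)/ltW.
exists g; split; first exact: fF.
split=> //.
- by move=> x Fx; split; [exact: fF|exact: mle].
- by move=> y [F'y /= ym]; have [] := gP _ F'y ym.
- move=> x Fx; have [Fg fg] := gP _ (fF _ Fx) (mle _ Fx).
  exact: finj.
- by move=> y [F'y /= ym]; have [] := gP _ F'y ym.
Qed.

End WellOrderedSpace.

Lemma infinite_injectionP T (A : set T) :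
  infinite_set A <-> exists2 e : nat -> T, injective e & forall n, A (e n).
Proof.
elim/Ppointed: T => T in A *.
  by rewrite emptyE; split=> [[]|[e _ /(_ 0%N)//]]; exact: finite_set0.
rewrite infiniteP; split=> [/ppcard_leP[f]|[e ie Ae]].
  exists f => [m n /inj|n]; first by apply; rewrite inE.
  by apply: funS.
by apply/pcard_leP/injfunPex; exists e => [n _|m n _ _ /ie//]; exact: Ae.
Qed.

(* [T] and [Z] are the two topmost nonempty Cantor-Bendixson derivatives; the order has been
   arranged so that its maximum [top] lies in [T]. *)
Record cb_model (X : topologicalType) d (W : orderType d) (rk : X -> W)
    (Z T : set X) (top : X) : Prop := CBModel {
  cb_wo : wo_space rk;
  cb_compact : compact [set: X];
  cb_closed : closed Z;
  cb_limit : T = limit_point Z;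
  cb_discrete : forall x, ~ limit_point T x;
  cb_invariant : forall A B f g x, phomeo A B f g -> A x -> Z x -> Z (f x);
  cb_top : T top;
  cb_max : forall x, rk x <= rk top }.

(** * Sectors, and the classification of their clopen pieces *)

Section Model.
Variables (X : topologicalType) (d : Order.disp_t) (W : orderType d) (rk : X -> W).
Variables (Z T : set X) (top : X).
Hypothesis cb : cb_model rk Z T top.
Implicit Types (A B C F : set X) (f g : X -> X) (x y p q : X).
Let wo := cb_wo cb.

Lemma finiteT : finite_set T.
Proof.
have := @finite_below _ _ _ _ wo T top (fun x _ => cb_discrete cb (x := x)).
by apply: sub_finite_set => x Tx; split=> //=; exact: cb_max cb x.
Qed.

Lemma subTZ : T `<=` Z.
Proof.
move=> x; rewrite (cb_limit cb) => /subset_limit_point.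
by have /closure_id <- := cb_closed cb.
Qed.

(** Put differently, the next point of [A] at or after [u] is a locally constant function of [u]
    away from the limit points of [A]. *)
Lemma not_limit_gap A x : ~ limit_point A x ->
  nbhs x [set u | rk u <= rk x /\ forall a, A a -> rk u <= rk a -> rk x <= rk a].
Proof.
rewrite not_limit_pointE => -[U /(rk_nbhs wo) nU UA].
have ox := rk_le_open wo x.
case: nU => [[y yx yU]|xU].
  have oy := rk_gt_open wo y.
  apply: filterS (open_nbhs_nbhs (conj (openI ox oy) _)); last by split=> /=.
  move=> u [/= ux yu]; split=> // a Aa ua; rewrite leNgt; apply/negP => ax.
  have : a = x by apply: UA; split=> //; apply: yU; [exact: lt_le_trans ua|exact: ltW].
  by move=> E; rewrite E ltxx in ax.
apply: filterS (open_nbhs_nbhs (conj ox _)); last by rewrite /=.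
move=> u /= ux; split=> // a Aa ua; rewrite leNgt; apply/negP => ax.
have : a = x by apply: UA; split=> //; apply: xU; exact: ltW.
by move=> E; rewrite E ltxx in ax.
Qed.

(** For [p] in [T], the interval that ends at [p] and starts just after the previous point of [T],
    if there is one. *)
Definition sector p : set X :=
  [set x | rk x <= rk p /\ forall t, T t -> rk x <= rk t -> rk p <= rk t].

Definition psector p : set X := sector p `\ p.

Lemma sector_refl p : sector p p.
Proof. by split=> /=. Qed.

Lemma sector_cover x : exists2 p, T p & sector p x.
Proof.
have [|p [Tp xp] lp] := rk_min wo (A := [set t | T t /\ rk x <= rk t]).
  by exists top; split; [exact: cb_top cb|exact: cb_max cb x].
by exists p => //; split=> // t Tt xt; exact: lp.
Qed.

Lemma sector_inj p q x : T p -> T q -> sector p x -> sector q x -> p = q.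
Proof.
move=> Tp Tq [xp px] [xq qx]; apply: (rk_inj wo); apply/eqP; rewrite eq_le.
by rewrite px// qx.
Qed.

Lemma sectorT p q : T p -> T q -> sector p q -> q = p.
Proof. by move=> Tp Tq pq; apply: sector_inj Tq Tp (sector_refl q) pq. Qed.

Lemma sector_open p : open (sector p).
Proof.
rewrite openE => x [xp px]; apply: filterS (not_limit_gap (cb_discrete cb (x := x))).
move=> u [ux ug]; split=> [|t Tt ut]; first exact: le_trans xp.
by apply: px => //; exact: ug.
Qed.

Lemma sector_clopen p : T p -> clopen (sector p).
Proof.
move=> Tp; split; first exact: sector_open.
have -> : sector p = ~` \bigcup_(q in T `\ p) sector q.
  apply/seteqP; split=> x.
    by move=> px [q [Tq /= qp] qx]; apply: qp; exact: sector_inj qx px.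
  move=> nx; have [q Tq qx] := sector_cover x.
  have [<-//|qp] := pselect (q = p).
  by exfalso; apply: nx; exists q.
by apply: open_closedC; apply: bigcup_open => q _; exact: sector_open.
Qed.

Lemma accX : accessible_space X.
Proof. exact/hausdorff_accessible/(wo_hausdorff wo). Qed.

Lemma open_setD1 A x : open A -> open (A `\ x).
Proof.
move=> oA; rewrite setDE; apply: openI => //.
exact/closed_openC/accessible_closed_set1/accX.
Qed.

Lemma psector_open p : open (psector p).
Proof. exact/open_setD1/sector_open. Qed.

Lemma psectorNT p x : T p -> psector p x -> ~ T x.
Proof. by move=> Tp [px /= xp] Tx; apply: xp; exact: sectorT px. Qed.

Lemma psector_lt p x : psector p x -> rk x < rk p.
Proof.
move=> [[xp _] /= xNp]; rewrite lt_neqAle xp andbT.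
by apply/eqP => /(rk_inj wo).
Qed.

(** A limit point at or below [y] would be a point of [T] in the sector other than [p], and there is
    none: inside a sector, [Z] accumulates at [p] only. *)
Lemma sector_finite p y : T p -> rk y < rk p ->
  finite_set (Z `&` sector p `&` [set x | rk x <= rk y]).
Proof.
move=> Tp yp; apply: (finite_below wo) => x xy lx.
have Tx : T x.
  rewrite (cb_limit cb) => U /lx[z [zx [Zz _] Uz]].
  by exists z.
have px : sector p x.
  have [_ /closure_id ->] := sector_clopen Tp.
  by move=> U /lx[z [_ [_ pz] Uz]]; exists z.
by move: xy; rewrite (sectorT Tp Tx px) leNgt yp.
Qed.

Definition zinf A := infinite_set (Z `&` A).

Lemma zinfS A B : A `<=` B -> zinf A -> zinf B.
Proof. by move=> sAB; apply: sub_infinite_set => x [? ?]; split=> //; exact: sAB. Qed.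

Lemma zinfU A B : zinf (A `|` B) -> zinf A \/ zinf B.
Proof.
move=> iAB; apply: contrapT => /not_orP[/contrapT fA /contrapT fB]; apply: iAB.
by rewrite setIUr finite_setU.
Qed.

Lemma psector_zinf p : T p -> zinf (psector p).
Proof.
move=> Tp fin; have lp := Tp; rewrite (cb_limit cb) in lp.
have oN : open (sector p `&` ~` (Z `&` psector p)).
  apply: openI; first exact: sector_open.
  by apply: closed_openC; have := accX; rewrite accessible_finite_set_closed; exact.
have pN : (sector p `&` ~` (Z `&` psector p)) p.
  by split; [exact: sector_refl|move=> [_ [_]]; apply].
have [z [zp Zz [pz nz]]] := lp _ (open_nbhs_nbhs (conj oN pN)).
by apply: nz; split=> //; split=> //; exact/eqP.
Qed.

(** Relatively clopen subsets of the punctured sector. Such a set may accumulate at [p] and is then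
    not closed in [X]. *)
Definition psub p A := [/\ open A, open (psector p `\` A) & A `<=` psector p].

Lemma psub_psector p : psub p (psector p).
Proof. by split=> //; [exact: psector_open|rewrite setDv; exact: open0]. Qed.

Lemma psubI p A B : psub p A -> psub p B -> psub p (A `&` B).
Proof.
move=> [oA cA sA] [oB cB sB]; split; first exact: openI.
  by rewrite setDIr; exact: openU.
by move=> x [/sA].
Qed.

Lemma psubU p A B : psub p A -> psub p B -> psub p (A `|` B).
Proof.
move=> [oA cA sA] [oB cB sB]; split; first exact: openU.
  by rewrite setDUr; exact: openI.
by move=> x [/sA|/sB].
Qed.

Lemma psubD p A B : psub p A -> psub p B -> psub p (A `\` B).
Proof.
move=> [oA cA sA] [oB cB sB]; have sD : A `\` B `<=` psector p by move=> x [/sA].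
have -> : A `\` B = A `&` (psector p `\` B).
  by apply/seteqP; split=> x [Ax]; [move=> nB; split=> //; split=> //; exact: sA|case].
by apply: psubI => //; split=> //; rewrite setDD; exact: openI (psector_open p) oB.
Qed.

Lemma psub_clopen p A : clopen A -> A `<=` psector p -> psub p A.
Proof.
move=> [oA cA] sA; split=> //; rewrite setDE; apply: openI; first exact: psector_open.
exact: closed_openC.
Qed.

Lemma psub_closedU1 p A : T p -> psub p A -> closed (A `|` [set p]).
Proof.
move=> Tp [oA cA sA].
have -> : A `|` [set p] = ~` (~` sector p `|` (psector p `\` A)).
  rewrite setCU setCK; apply/seteqP; split=> x.
    move=> [Ax|->]; first by split; [have [] := sA _ Ax|move=> []].
    by split; [exact: sector_refl|move=> [[_ np] _]; exact: np].
  move=> [px nx]; have [->|xp] := pselect (x = p); [by right|left].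
  by apply: contrapT => nA; apply: nx; split.
apply: open_closedC; apply: openU => //; apply: closed_openC.
by case: (sector_clopen Tp).
Qed.

(** The copy of [A] fills an initial section ending at [f p]. Were [f p] before [p'], infinitely
    many points of [Z] would land below [f p], where the sector of [p'] has finitely many. So
    [f p = p'], and nothing of [A'] is left over. *)
Lemma psub_homeo_of_emb p p' A A' f : T p -> T p' -> psub p A -> psub p' A' -> zinf A ->
  initial_emb rk (A `|` [set p]) (A' `|` [set p']) f -> homeomorphic A A'.
Proof.
move=> Tp Tp' rA rA' iA emb.
have [oA cA sA] := rA; have [oA' cA' sA'] := rA'.
have [|x|g [F'fp iso]] := @initial_emb_iso _ _ _ _ wo _ _ _ p emb; first by right.
  by case=> [/sA/psector_lt/ltW|->].
set F' := (A' `|` [set p']) `&` _ in iso.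
pose O' := F' `\ f p.
have [fF gF fK gK mf] := iso.
have Ap x : A x -> x <> p by move=> /sA[].
have cF' : closed F'.
  by apply: closedI; [exact: psub_closedU1|have [] := rk_le_clopen wo (f p)].
have O'E : O' = A' `&` ([set y | rk y <= rk (f p)] `\ f p).
  apply/seteqP; split=> y; last by move=> [A'y [yf ynf]]; split=> //; split=> //; left.
  move=> [[[A'y|->] /= yf] ynf]; first by split.
  case: (F'fp) => [/sA'/psector_lt|/= E]; first by rewrite ltNge yf.
  by exfalso; apply: ynf; rewrite /= E.
have oO' : open O' by rewrite O'E; apply: openI => //; exact/open_setD1/(rk_le_open wo).
have ph : phomeo A O' f g.
  apply: (order_iso_phomeo wo (psub_closedU1 Tp rA) cF' iso) => //.
  - by move=> x [].
  - move=> x Ax; split; first by apply: fF; left.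
    move=> /= E; apply: (Ap x Ax).
    by rewrite -(fK p) -?E ?fK//; [left|right].
  - move=> y [F'y /= ynf]; have [//|E] := gF _ F'y.
    by exfalso; apply: ynf; rewrite -E gK.
case: F'fp => [A'fp|fpE].
  case: iA; have fin := sector_finite Tp' (psector_lt (sA' _ A'fp)).
  apply: sub_finite_set (finite_image g fin) => x [Zx Ax].
  exists (f x); last by apply: fK; left.
  have [[[A'fx|fxE] fle] _] := ph_fun ph Ax.
    have Zfx := cb_invariant cb ph Ax Zx.
    by split=> //; split=> //; have [] := sA' _ A'fx.
  move: fle; rewrite /= fxE => /le_lt_trans/(_ (psector_lt (sA' _ A'fp))).
  by rewrite ltxx.
exists f, g; suff <- : O' = A' by [].
rewrite O'E; apply/seteqP; split=> [y []//|y A'y]; split=> //.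
rewrite fpE; split; last by move=> /= yE; have [_ /=] := sA' _ A'y.
exact: ltW (psector_lt (sA' _ A'y)).
Qed.

Lemma psub_homeo p p' A A' : T p -> T p' -> psub p A -> psub p' A' -> zinf A -> zinf A' ->
  homeomorphic A A'.
Proof.
move=> Tp Tp' rA rA' iA iA'.
case: (initial_emb_total wo (A `|` [set p]) (A' `|` [set p'])) => -[f emb].
  exact: psub_homeo_of_emb emb.
exact/homeomorphic_sym/(psub_homeo_of_emb _ _ _ _ _ emb).
Qed.

(** The point [c] need not be the last one of [C]. Cells are first compared up to their points of
    [Z]; [cell_absorb] takes care of what lies beyond. *)
Definition cell C c := [/\ clopen C, C c, Z c & forall z, Z z -> C z -> z = c].

(** The image ends at [f c], which is a point of [Z] and hence [c']; as [c'] is last in [C'], the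
    image is all of [C']. *)
Lemma cell_homeo_of_emb C C' c c' f : cell C c -> cell C' c' ->
  (forall x, C x -> rk x <= rk c) -> (forall x, C' x -> rk x <= rk c') ->
  initial_emb rk C C' f -> homeomorphic C C'.
Proof.
move=> [[oC cC] Cc Zc zC] [[oC' cC'] C'c' Zc' zC'] mC mC' emb.
have [//|//|g [C'fc iso]] := @initial_emb_iso _ _ _ _ wo _ _ _ c emb.
have [o c_] := rk_le_clopen wo (f c).
have ph : phomeo C (C' `&` [set y | rk y <= rk (f c)]) f g.
  have [fF gF _ _ _] := iso.
  by apply: (order_iso_phomeo wo cC _ iso) => //; [exact: closedI|exact: openI].
exists f, g; have fcE : f c = c' by apply: (zC' _ (cb_invariant cb ph Cc Zc)).
suff <- : C' `&` [set y | rk y <= rk (f c)] = C' by [].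
by apply/seteqP; split=> [y []//|y C'y]; split=> //=; rewrite fcE; exact: mC'.
Qed.

Lemma cell_homeo_max C C' c c' : cell C c -> cell C' c' ->
  (forall x, C x -> rk x <= rk c) -> (forall x, C' x -> rk x <= rk c') -> homeomorphic C C'.
Proof.
move=> sC sC' mC mC'.
case: (initial_emb_total wo C C') => -[f emb]; first exact: cell_homeo_of_emb sC sC' mC mC' emb.
exact/homeomorphic_sym/(cell_homeo_of_emb sC' sC mC' mC emb).
Qed.

Lemma cell_cut C c : cell C c -> cell (C `&` [set x | rk x <= rk c]) c.
Proof.
move=> [cC Cc Zc zC]; split=> //; last by move=> z Zz [Cz _]; exact: zC.
- by apply: clopenI => //; exact: rk_le_clopen.
- by split=> /=.
Qed.

(* The part of a cell above its top-rank point is a copy of an initial piece of the part below,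
   and what remains below is homeomorphic to the whole part below. *)
Lemma cell_absorb C c : cell C c -> homeomorphic (C `&` [set x | rk x <= rk c]) C.
Proof.
move=> sC; have sA := cell_cut sC; have [[oC cC] Cc Zc zC] := sC.
set A := C `&` _ in sA *.
pose L := C `&` [set x | rk c < rk x].
have CE : C = A `|` L.
  rewrite -setIUr -[LHS]setIT; congr (_ `&` _).
  by apply/seteqP; split=> x //= _; have [] := leP (rk x) (rk c); [left|right].
have cL : clopen L by apply: clopenI => //; exact: rk_gt_clopen.
have [oL clL] := cL; have [[oA cA] Ac _ zA] := sA.
have nZL x : L x -> ~ Z x.
  by move=> [Cx /= cx] Zx; move: cx; rewrite (zC x Zx Cx) ltxx.
have [[x Lx]|nL] := pselect (L !=set0); last first.
  suff <- : A = C by exact: homeomorphic_refl.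
  by rewrite [RHS]CE; apply/seteqP; split=> x; [left|case=> // Lx; case: nL; exists x].
have [l Ll ml] : exists2 m, L m & forall z, L z -> rk z <= rk m.
  by apply: (closed_max wo clL Lx); exists top => z _; exact: cb_max cb z.
(* An embedding of [A] into [L] would put a point of [Z] into [L]. So [L] embeds into [A], and for
   the same reason its image stays below [c]. *)
case: (initial_emb_total wo L A) => -[f emb]; last first.
  have [//|y [_ /= //]|g [Lfc iso]] := @initial_emb_iso _ _ _ _ wo _ _ _ c emb.
  have [o c_] := rk_le_clopen wo (f c).
  have ph : phomeo A (L `&` [set y | rk y <= rk (f c)]) f g.
    have [fF gF _ _ _] := iso.
    by apply: (order_iso_phomeo wo cA _ iso) => //; [exact: closedI|exact: openI].
  by case: (nZL _ Lfc (cb_invariant cb ph Ac Zc)).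
have [//|//|g [Afl iso]] := @initial_emb_iso _ _ _ _ wo _ _ _ l emb.
have [o c_] := rk_le_clopen wo (f l).
set I := A `&` [set y | rk y <= rk (f l)] in iso.
have ph : phomeo L I f g.
  have [fF gF _ _ _] := iso.
  by apply: (order_iso_phomeo wo clL _ iso) => //; [exact: closedI|exact: openI].
have flc : rk (f l) < rk c.
  have [_ /= flc] := Afl; rewrite lt_neqAle flc andbT; apply/eqP => /(rk_inj wo) E.
  have Ic : I c by split=> //=; rewrite E.
  have phs := phomeo_sym ph.
  exact: nZL _ (ph_inv ph Ic) (cb_invariant cb phs Ic Zc).
pose R := A `&` [set y | rk (f l) < rk y].
have sR : cell R c.
  split=> //; last by move=> z Zz [Az _]; exact: zA.
  by apply: clopenI => //; exact: rk_gt_clopen.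
have AE : A = R `|` I.
  rewrite -setIUr -[LHS]setIT; congr (_ `&` _).
  by apply/seteqP; split=> y //= _; have [] := leP (rk y) (rk (f l)); [right|left].
rewrite {1}AE CE; apply: homeomorphic_setU.
- apply: (cell_homeo_max sR sA); first by move=> y [[_ /= //]].
  by move=> y [_ /= //].
- by exists g, f; exact: phomeo_sym.
- by move=> y [_ /= /lt_le_trans h] [_ /= /h]; rewrite ltxx.
- by move=> y [_ /= /le_lt_trans h] [_ /= /h]; rewrite ltxx.
Qed.

Lemma cell_homeo C C' c c' : cell C c -> cell C' c' -> homeomorphic C C'.
Proof.
move=> sC sC'; apply: homeomorphic_trans (homeomorphic_sym (cell_absorb sC)) _.
apply: homeomorphic_trans (cell_absorb sC').
apply: (cell_homeo_max (cell_cut sC) (cell_cut sC')); by move=> y [_ /= //].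
Qed.

(** Infinitely many points of [Z] in [A] receive labels in [J], each label infinitely often, and
    every point takes the label of the next point of [Z]. This labelling is locally constant off
    [T], so the pieces are relatively clopen. *)
Lemma psub_split p A (J : countType) (j0 : J) : T p -> psub p A -> zinf A ->
  exists nu : X -> J, forall j, psub p (A `&` nu @^-1` [set j]) /\ zinf (A `&` nu @^-1` [set j]).
Proof.
move=> Tp [oA cA sA] /infinite_injectionP[e ie Ae].
have nextP x : exists z, [/\ Z z, rk x <= rk z & forall a, Z a -> rk x <= rk a -> rk z <= rk a].
  have [|z [Zz xz] lz] := rk_min wo (A := [set a | Z a /\ rk x <= rk a]).
    by exists top; split; [exact/subTZ/(cb_top cb)|exact: cb_max cb x].
  by exists z; split=> // a Za xa; exact: lz.
pose next x := projT1 (cid (nextP x)).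
have nextE x z : Z z -> rk x <= rk z -> (forall a, Z a -> rk x <= rk a -> rk z <= rk a) -> next x = z.
  move=> Zz xz lz; rewrite /next; case: cid => y /= [Zy xy ly].
  by apply: (rk_inj wo); apply/eqP; rewrite eq_le lz// ly.
(* The point with index [pickle (j, k)] gets the label [j]; points outside the enumeration and
   indices that code no pair get [j0]. *)
pose lab z := if pselect (exists n, e n = z) is left ex then
  (if unpickle (projT1 (cid ex)) is Some jk then (jk : J * nat).1 else j0) else j0.
have labE (j : J) (k : nat) : lab (e (pickle (j, k))) = j.
  rewrite /lab; case: pselect => [ex|[]]; last by eexists.
  by case: cid => n /= /ie ->; rewrite pickleK.
pose nu x := lab (next x).
have onu (Q : set J) B : open B -> B `<=` psector p -> open (B `&` nu @^-1` Q).
  move=> oB sB; rewrite openE => x [Bx Qx].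
  have nx : ~ limit_point Z x by rewrite -(cb_limit cb); exact: psectorNT (sB _ Bx).
  apply: filterI; first exact: open_nbhs_nbhs.
  apply: filterS (not_limit_gap nx) => u [ux ug].
  suff E : next u = next x by rewrite /preimage /= /nu E.
  have [Zn xn ln] := projT2 (cid (nextP x)).
  apply: nextE => //; first exact: le_trans xn.
  by move=> a Za ua; apply: ln => //; exact: ug.
exists nu => j; split; first split.
- exact: onu.
- have -> : psector p `\` (A `&` nu @^-1` [set j]) =
      (psector p `\` A) `|` (A `&` nu @^-1` (~` [set j])).
    apply/seteqP; split=> x.
      move=> [px nx]; have [Ax|nA] := pselect (A x); last by left.
      by right; split=> // jx; apply: nx.
    by move=> [[px nA]|[Ax nj]]; split=> //; [case|exact: sA|case].
  by apply: openU => //; exact: onu.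
- by move=> x [/sA].
- apply/infinite_injectionP; exists (fun k => e (pickle (j, k))).
    by move=> k k' /ie/(pcan_inj pickleK)[].
  move=> k; have [Zk Ak] := Ae (pickle (j, k)); split=> //; split=> //=.
  by rewrite /nu (nextE _ (e (pickle (j, k)))) ?labE.
Qed.

End Model.

(** * Supports and lengths of homeomorphisms *)

Section Support.
Variable X : topologicalType.
Implicit Types (A B : set X) (h k : haut X).

Definition supported A h := forall x, ~ A x -> h x = x.

Lemma hinv_fix h x : h x = x -> hinv h x = x.
Proof. by move=> hx; rewrite -{1}hx hfunK. Qed.

Lemma supportedV A h : supported A h -> supported A (hautV h).
Proof. by move=> sh x nA; apply: hinv_fix; exact: sh. Qed.

Lemma supported_stable A h x : supported A h -> A x -> A (h x).
Proof.
move=> sh Ax; apply: contrapT => nA; apply: (nA).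
by have := sh _ nA => /(can_inj (@hfunK _ h)) ->.
Qed.

Lemma supported_phomeo A h : open A -> supported A h -> phomeo A A h (hinv h).
Proof.
move=> oA sh; split=> //.
- by move=> x; exact: supported_stable.
- by move=> x; exact: supported_stable (supportedV sh).
- by move=> x _; rewrite hfunK.
- by move=> x _; rewrite hinvK.
- by move=> x _; exact: hcfun.
- by move=> x _; exact: hcinv.
Qed.

(* [E n] stands for the ball of radius [n] around the identity in a left-invariant metric. *)
Record scale (E : nat -> set (haut X)) : Prop := Scale {
  scaleM : forall m n h k, E m h -> E n k -> E (m + n)%N (hautM h k);
  scaleV : forall n h, E n h -> E n (hautV h);
  scaleW : forall m n h, (m <= n)%N -> E m h -> E n h;
  scaleT : forall h, exists n, E n h }.

Definition bounded_on (E : nat -> set (haut X)) A :=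
  exists K, forall h, supported A h -> E K h.

(** Conjugation by [h] turns support in [A] into support in [B], at the cost of two factors of
    length at most [n]. *)
Lemma bounded_on_conj E A B h : scale E -> (forall x, A x -> B (h x)) ->
  bounded_on E B -> bounded_on E A.
Proof.
move=> sE hAB [K EK]; have [n En] := scaleT sE h.
exists (n + (K + n))%N => f sf.
have -> : f = hautM (hautV h) (hautM (hautM h (hautM f (hautV h))) h).
  by apply: haut_eq => x /=; rewrite !hfunK.
apply: (scaleM sE); first exact: scaleV.
apply: (scaleM sE) => //; apply: EK => x nB /=.
by rewrite sf ?hinvK// => /hAB; rewrite hinvK.
Qed.

End Support.

(** * Bergman's argument in one sector, then in all sectors *)

Section Bergman.
Variables (X : topologicalType) (d : Order.disp_t) (W : orderType d) (rk : X -> W).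
Variables (Z T : set X) (top : X).
Hypothesis cb : cb_model rk Z T top.
Local Notation sector := (sector rk T).
Local Notation psector := (psector rk T).
Local Notation psub := (psub rk T).
Local Notation zinf := (zinf Z).
Implicit Types (A B V : set X) (h k : haut X).

Lemma zinf_phomeo A B f g : phomeo A B f g -> zinf A -> zinf B.
Proof.
move=> ph iA fB; apply: iA; apply: sub_finite_set (finite_image g fB) => x [Zx Ax].
exists (f x); last exact: ph_funK ph _ Ax.
by split; [exact: (cb_invariant cb ph Ax Zx)|exact: ph_fun ph _ Ax].
Qed.

Lemma haut_Z h x : Z x -> Z (h x).
Proof. by move=> Zx; apply: (cb_invariant cb (haut_phomeo h openT) _ Zx). Qed.

Lemma haut_T h x : T x -> T (h x).
Proof.
rewrite (cb_limit cb) => lx U /(@hcfun _ h x)/lx[z [zx Zz Uz]].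
exists (h z); split=> //; last exact: haut_Z.
by apply: contra_neq zx => /(can_inj (@hfunK _ h)).
Qed.

Section AtPoint.
Variable p : X.
Hypothesis Tp : T p.

(** [V] may accumulate at [p], where gluing with the identity is not evidently continuous. Therefore
    the map is extended by the identity to the punctured sector, and then over [p] by
    compactness. *)
Lemma psub_haut V f g : psub p V -> phomeo V V f g ->
  exists h, (forall x, V x -> h x = f x) /\ supported V h.
Proof.
move=> [oV cV sV] ph.
have dis x : V x -> (psector p `\` V) x -> False by move=> Vx [_ []].
have [f1 [g1 [ph1 f1V f1N]]] := phomeo_setU ph (phomeo_id cV) dis dis.
have E : V `|` (psector p `\` V) = psector p by apply: setDUK.
rewrite E in ph1.
have cs := sector_clopen cb Tp.
have [f2 [g2 [ph2 f2p f2E]]] := phomeo_fill (wo_hausdorff (cb_wo cb)) (cb_compact cb)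
  cs cs (sector_refl _ _ p) (sector_refl _ _ p) ph1.
have [h [hs hN]] := haut_extend_id cs ph2.
exists h; split=> x.
  by move=> Vx; have [sx xp] := sV _ Vx; rewrite hs// f2E// f1V.
move=> nV; have [sx|/hN//] := pselect (sector p x).
rewrite hs//; have [->//|xp] := pselect (x = p).
by rewrite f2E// f1N.
Qed.

Lemma psub_haut_extend V A B f g : psub p V -> A `<=` V -> B `<=` V ->
  phomeo A B f g -> homeomorphic (V `\` A) (V `\` B) ->
  exists h, (forall x, A x -> h x = f x) /\ supported V h.
Proof.
move=> rV sA sB ph [f' [g' ph']].
have dis D x : D x -> (V `\` D) x -> False by move=> Dx [_ []].
have [f1 [g1 [ph1 f1A _]]] := phomeo_setU ph ph' (dis A) (dis B).
rewrite !setDUK// in ph1.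
have [h [hV sh]] := psub_haut rV ph1.
by exists h; split=> // x Ax; rewrite hV ?f1A//; exact: sA.
Qed.

Lemma psub_preimage V h : psub p V -> supported (psector p) h -> psub p (h @^-1` V).
Proof.
move=> [oV cV sV] sh; split.
- by apply: open_comp => // x _; exact: hcfun.
- have -> : psector p `\` h @^-1` V = h @^-1` (psector p `\` V).
    apply/seteqP; split=> x [px nx]; split=> //; first exact: supported_stable.
    rewrite -(hfunK h x); exact: (supported_stable (supportedV sh)).
  by apply: open_comp => // x _; exact: hcfun.
- move=> x /sV hx; rewrite -(hfunK h x).
  exact: (supported_stable (supportedV sh)).
Qed.

Variable E : nat -> set (haut X).
Hypothesis sE : scale E.

Let J : countType := (nat * (nat + nat))%type.
(* [inl k] stands for the integer [k] and [inr k] for [- k - 1]. *)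
Let succ (i : nat + nat) : nat + nat :=
  match i with inl k => inl k.+1 | inr 0%N => inl 0%N | inr k.+1 => inr k end.
Let pred (i : nat + nat) : nat + nat :=
  match i with inl 0%N => inr 0%N | inl k.+1 => inl k | inr k => inr k.+1 end.

(* Cut [psector p] into copies [B (n, i)] of one set, [n] in nat and [i] in Z. If no
   homeomorphism group of a [B (n, 0)] were bounded, choose [f n] in that group, very long
   compared with the shift [sigma n] of the row [n]. Let [F] act as [f n] on all the [B (n, i)],
   [i >= 0]. Then [f n] is the commutator of [F] and [sigma n], which is too short for [n]
   the length of [F]. *)
Lemma bounded_piece : exists B, [/\ psub p B, zinf B, zinf (psector p `\` B) & bounded_on E B].
Proof.
have [nu nuP] := psub_split cb ((0, inl 0)%N : J) Tp (psub_psector cb p) (psector_zinf cb Tp).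
pose B j := psector p `&` nu @^-1` [set j].
have Binj i j x : B i x -> B j x -> i = j by move=> [_ /= <-] [_ /= <-].
have rB j : psub p (B j) by have [] := nuP j.
have iB j : zinf (B j) by have [] := nuP j.
have sB j x : B j x -> psector p x by case.
have /choice[fi] : forall j, exists fg : (X -> X) * (X -> X), phomeo (B (0, inl 0)%N) (B j) fg.1 fg.2.
  by move=> j; have [f [g ph]] := psub_homeo cb Tp Tp (rB (0, inl 0)%N) (rB j) (iB _) (iB j); exists (f, g).
set B0 := B _ => fiP.
pose phi j := (fi j).1; pose psi j := (fi j).2.
have phiP j b : B0 b -> B j (phi j b) := ph_fun (fiP j) (x := b).
have psiP j x : B j x -> B0 (psi j x) := ph_inv (fiP j) (y := x).
have phiK j b : B0 b -> psi j (phi j b) = b := ph_funK (fiP j) (x := b).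
have psiK j x : B j x -> phi j (psi j x) = x := ph_invK (fiP j) (y := x).
(* Any permutation [t] of the copies, combined with any homeomorphisms [u j] of the model [B0],
   comes from one homeomorphism of [X]. *)
have grid (t t' : J -> J) (u u' : J -> X -> X) : cancel t t' -> cancel t' t ->
    (forall j, phomeo B0 B0 (u j) (u' j)) ->
    exists h, (forall j b, B0 b -> h (phi j b) = phi (t j) (u j b)) /\ supported (psector p) h.
  move=> tK t'K phu.
  have [|i j x Bi Bj|j|f [g [ph fE _]]] := @phomeo_bigcup X J B (fun j => B (t j))
     (fun j => (phi (t j) \o u j) \o psi j) (fun j => phi j \o (u' j \o psi (t j))).
  - exact: Binj.
  - exact/(can_inj tK)/(Binj _ _ _ Bi Bj).
  - apply: phomeo_comp (phomeo_sym (fiP j)) _.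
    exact: phomeo_comp (phu j) (fiP (t j)).
  have YE : \bigcup_j B j = psector p.
    by apply/seteqP; split=> [x [j _ []]//|x px]; exists (nu x).
  have YE' : \bigcup_j B (t j) = psector p.
    by apply/seteqP; split=> [x [j _ []]//|x px]; exists (t' (nu x)) => //; rewrite t'K.
  rewrite YE YE' in ph.
  have [h [hE sh]] := psub_haut (psub_psector cb p) ph.
  exists h; split=> // j b Bb; rewrite hE; last exact: sB (phiP j _ Bb).
  by rewrite (fE j) /=; [rewrite phiK|exact: phiP].
apply: contrapT => nB.
have nbd n : ~ bounded_on E (B (n, inl 0)%N).
  move=> bn; apply: nB; exists (B (n, inl 0)%N); split=> //.
  apply: zinfS (iB (n, inl 1)%N) => x Bx; split; first exact: sB Bx.
  by move=> /(Binj _ _ _ Bx).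
pose sh n (j : J) : J := (j.1, if j.1 == n then succ j.2 else j.2).
pose sh' n (j : J) : J := (j.1, if j.1 == n then pred j.2 else j.2).
have oB0 : open B0 by have [] := rB (0, inl 0)%N.
have /choice[sig sigP] : forall n, exists s : haut X, (forall j b, B0 b -> s (phi j b) = phi (sh n j) b)
    /\ supported (psector p) s.
  move=> n; apply: (grid (sh n) (sh' n) (fun=> id) (fun=> id)).
  - by case=> m i; rewrite /sh /sh' /=; case: eqP => // _; case: i => [k|[|k]].
  - by case=> m i; rewrite /sh /sh' /=; case: eqP => // _; case: i => [[|k]|k].
  - by move=> j; exact: phomeo_id.
have /choice[l lP] : forall n, exists l, E l (sig n) by move=> n; exact: scaleT.
(* The excluded radius bounds the commutator of [sig n] with any map of length at most [n]. Below,
   the row is taken to be a bound [m] for the length of [F]. *)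
have /choice[f fP] : forall n, exists f, supported (B (n, inl 0)%N) f /\ ~ E ((n + l n) + (n + l n))%N f.
  move=> n; apply: contrapT => nf; apply: (nbd n); exists ((n + l n) + (n + l n))%N => f sf.
  by apply: contrapT => nE; apply: nf; exists f.
pose j0 (n : nat) : J := (n, inl 0%N).
pose u (j : J) := if j.2 is inl _ then psi (j0 j.1) \o (f j.1 \o phi (j0 j.1)) else id.
pose u' (j : J) := if j.2 is inl _ then psi (j0 j.1) \o hinv (f j.1) \o phi (j0 j.1) else id.
have [F [FE sF]] : exists h, (forall j b, B0 b -> h (phi j b) = phi j (u j b)) /\ supported (psector p) h.
  apply: (grid id id u u') => // -[n [k|k]]; rewrite /u /u' /=; last exact: phomeo_id.
  have [sfn _] := fP n; have oBn : open (B (j0 n)) by have [] := rB (j0 n).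
  apply: phomeo_comp (phomeo_sym (fiP (j0 n))).
  exact: phomeo_comp (fiP _) (supported_phomeo oBn sfn).
have uP j b : B0 b -> B0 (u j b).
  case: j => n [k|k] Bb //; rewrite /u /=; apply: psiP.
  by have [sfn _] := fP n; apply: supported_stable => //; exact: phiP.
have [m Em] := scaleT sE F.
have [sfm nE] := fP m; have [sigE ssig] := sigP m.
apply: nE.
(* On row [m], for index at least 0 both sides apply the copy of [f m] once, and the outer [f m]
   sees nothing. The piece of index -1 is shifted onto piece 0, where [F] and [f m] agree. Pieces of
   lower index are merely shifted. *)
have comm x : F (sig m x) = f m (sig m (F x)).
  have [px|npx] := pselect (psector p x); last first.
    by rewrite (sF x)// !(ssig x)// (sF x)// sfm// => /sB.
  have [j [b [Bb ->]]] : exists j b, B0 b /\ x = phi j b.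
    have Bx : B (nu x) x by [].
    by exists (nu x), (psi (nu x) x); rewrite psiK//; split=> //; exact: psiP Bx.
  rewrite sigE// FE// FE// sigE//; last exact: uP.
  have fix_ i c : B0 c -> i <> j0 m -> f m (phi i c) = phi i c.
    by move=> Bc ni; apply: sfm => /(Binj _ _ _ (phiP i _ Bc)).
  case: j => n i; rewrite /sh /=; have [->|nm] := eqVneq n m; last first.
    by rewrite fix_//; [exact: uP|move=> [nm']; rewrite nm' eqxx in nm].
  case: i => [k|[|k]] /=.
  - by rewrite fix_//; exact: (uP (m, inl k)).
  - by rewrite /u /= psiK//; apply: (supported_stable sfm); exact: phiP.
  - by rewrite fix_.
have -> : f m = hautM (hautM F (sig m)) (hautM (hautV F) (hautV (sig m))).
  by apply: haut_eq => x /=; rewrite comm !hinvK.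
by apply: (scaleM sE); apply: (scaleM sE) => //; exact: scaleV.
Qed.

(** Homeomorphisms of [X] carry any relatively clopen set with infinitely many points of [Z] inside
    and outside to any other such set, so a single bounded one suffices. *)
Lemma bounded_moiety V : psub p V -> zinf V -> zinf (psector p `\` V) -> bounded_on E V.
Proof.
move=> rV iV iV'; have [B [rB iB iB' bB]] := bounded_piece.
have rY := psub_psector cb p.
have [f [g ph]] := psub_homeo cb Tp Tp rV rB iV iB.
have hN := psub_homeo cb Tp Tp (psubD cb rY rV) (psubD cb rY rB) iV' iB'.
have [h [hV _]] := psub_haut_extend rY (let: And3 _ _ s := rV in s) (let: And3 _ _ s := rB in s) ph hN.
by apply: (bounded_on_conj (h := h) sE _ bB) => x Vx; rewrite hV//; exact: ph_fun ph _ Vx.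
Qed.

(** [g] undoes [f] on a piece [P1] of [P], and [h] blows [P1] up to [P], both supported in [V]. Then
    [h g f h^-1] is the identity on [P], and [f = g^-1 h^-1 (h g f h^-1) h] has four factors of
    length at most [C]. *)
Lemma bergman_step V P C f : psub p V -> psub p P -> P `<=` V -> zinf (V `\` P) ->
  (forall h, supported V h -> E C h) ->
  (forall h, supported (psector p `\` P) h -> E C h) ->
  supported (psector p) f -> zinf (P `&` f @^-1` V) ->
  E (C + (C + (C + C)))%N f.
Proof.
move=> rV rP sPV iVP bV bP sf iQ.
have rQ := psubI rP (psub_preimage rV sf).
have [nu nuP] := psub_split cb 0%N Tp rQ iQ.
set Q := P `&` _ in rQ iQ nuP.
pose P1 := Q `&` nu @^-1` [set 0%N].
(* [P2] is a reserve: it keeps infinitely many points of [Z] in [V] outside [P1], and its image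
   under [f] does so outside the image of [P1]. *)
pose P2 := Q `&` nu @^-1` [set 1%N].
have [rP1 iP1] := nuP 0%N; have [rP2 iP2] := nuP 1%N.
rewrite -/P1 in rP1 iP1; rewrite -/P2 in rP2 iP2.
have [oP1 _ sP1] := rP1; have [oP2 _ sP2] := rP2.
have sP1V : P1 `<=` V by move=> x [[/sPV]].
have P12 x : P1 x -> P2 x -> False by move=> [_ /= e0] [_ /=]; rewrite e0.
have phf A := haut_phomeo f (A := A).
pose fP1 := hinv f @^-1` P1.
have rfP1 : psub p fP1 by apply: (psub_preimage (h := hautV f)) => //; exact: supportedV.
have sfP1V : fP1 `<=` V by move=> x [[_]]; rewrite /preimage /= hinvK.
have ifP1 : zinf fP1 by apply: zinf_phomeo (phf _ oP1) iP1.
have iVf : zinf (V `\` fP1).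
  apply: zinfS (zinf_phomeo (phf _ oP2) iP2) => x P2x.
  split; first by case: P2x => -[_]; rewrite /preimage /= hinvK.
  by move=> P1x; exact: P12 P1x P2x.
have iV1 : zinf (V `\` P1).
  apply: zinfS iP2 => x P2x; split; last by move=> P1x; exact: P12 P1x P2x.
  by case: P2x => -[/sPV].
have [g [gE sg]] := psub_haut_extend rV sfP1V sP1V (phomeo_sym (phf _ oP1))
  (psub_homeo cb Tp Tp (psubD cb rV rfP1) (psubD cb rV rP1) iVf iV1).
have iP : zinf P by apply: zinfS iP1 => x [[]].
have [phi [psi phh]] := psub_homeo cb Tp Tp rP1 rP iP1 iP.
have [h [hE sh]] := psub_haut_extend rV sP1V sPV phh
  (psub_homeo cb Tp Tp (psubD cb rV rP1) (psubD cb rV rP) iV1 iVP).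
have sVY : V `<=` psector p by have [] := rV.
have -> : f = hautM (hautV g) (hautM (hautV h) (hautM (hautM h (hautM (hautM g f) (hautV h))) h)).
  by apply: haut_eq => x /=; rewrite !hfunK.
apply: (scaleM sE); first exact/(scaleV sE)/bV.
apply: (scaleM sE); first exact/(scaleV sE)/bV.
apply: (scaleM sE); last exact: bV.
apply: bP => x nx /=.
have [Px|nPx] := pselect (P x); last first.
  have npx : ~ psector p x by move=> px; apply: nx.
  have nVx : ~ V x by move=> /sVY.
  by rewrite (hinv_fix (sh _ nVx)) sf// sg// sh.
have P1x := ph_inv phh Px.
have hx : hinv h x = psi x by rewrite -{1}(ph_invK phh Px) -hE// hfunK.
rewrite hx gE; last by rewrite /fP1 /preimage /= hfunK.
by rewrite hfunK hE//; exact: ph_invK phh _ Px.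
Qed.

Lemma bounded_psector : bounded_on E (psector p).
Proof.
have rY := psub_psector cb p.
have [nu nuP] := psub_split cb 0%N Tp rY (psector_zinf cb Tp).
pose N i := psector p `&` nu @^-1` [set i].
have rN i : psub p (N i) by have [] := nuP i.
have iN i : zinf (N i) by have [] := nuP i.
have dN i j x : i <> j -> N i x -> ~ N j x by move=> ij [_ /= ei] [_ /= ej]; apply: ij; rewrite -ei -ej.
(* [V1] and [V2] cover the punctured sector, so [f] sends infinitely many points of [Z] in [N 0]
   into one of them. Both contain [N 0] with an infinite remainder of [Z], and [N 2] leaves room
   outside [V1]. [V3] is the complement of [N 0]. *)
pose V1 := N 0%N `|` N 1%N; pose V2 := psector p `\` N 1%N; pose V3 := psector p `\` N 0%N.
have sub i j : i <> j -> N i `<=` psector p `\` N j.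
  by move=> ij x Nx; split; [case: Nx|exact: dN Nx].
have [C1 bC1] : bounded_on E V1.
  apply: bounded_moiety; first exact: psubU.
  - by apply: zinfS (iN 0%N) => x; left.
  - apply: zinfS (iN 2%N) => x Nx; split; first by case: Nx.
    by case; apply: dN Nx.
have [C2 bC2] : bounded_on E V2.
  apply: bounded_moiety; first exact: (psubD cb rY (rN 1%N)).
  - exact: zinfS (sub 0%N 1%N _) (iN 0%N).
  - apply: zinfS (iN 1%N) => x Nx; split; first by case: Nx.
    by move=> [].
have [C3 bC3] : bounded_on E V3.
  apply: bounded_moiety; first exact: (psubD cb rY (rN 0%N)).
  - exact: zinfS (sub 1%N 0%N _) (iN 1%N).
  - apply: zinfS (iN 0%N) => x Nx; split; first by case: Nx.
    by move=> [].
pose C := (C1 + (C2 + C3))%N.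
exists (C + (C + (C + C)))%N => f sf.
have bC : (forall h, supported V3 h -> E C h).
  by move=> h /bC3; apply: scaleW => //; rewrite /C addnA leq_addl.
have : zinf (N 0%N `&` f @^-1` V1) \/ zinf (N 0%N `&` f @^-1` V2).
  apply: zinfU; apply: zinfS (iN 0%N) => x Nx; rewrite -setIUr; split=> //.
  have px : psector p (f x) by apply: supported_stable => //; case: Nx.
  by have [N1|nN1] := pselect (N 1%N (f x)); [left; right|right].
case=> iQ.
  apply: (bergman_step (V := V1) (P := N 0%N)) => //.
  - exact: psubU.
  - by move=> x; left.
  - apply: zinfS (iN 1%N) => x Nx; split; first by right.
    exact: dN Nx.
  - by move=> h /bC1; apply: scaleW => //; rewrite /C leq_addr.
apply: (bergman_step (V := V2) (P := N 0%N)) => //.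
- exact: (psubD cb rY (rN 1%N)).
- exact: sub.
- apply: zinfS (iN 2%N) => x Nx; split; first exact: sub Nx.
  exact: dN Nx.
- move=> h /bC2; apply: scaleW => //; rewrite /C addnC -addnA; exact: leq_addr.
Qed.

End AtPoint.

Definition sector_stable h := forall p x, T p -> sector p x -> sector p (h x).

Lemma sector_stableV h : sector_stable h -> sector_stable (hautV h).
Proof.
move=> sh p x Tp px /=; have [q Tq qx] := sector_cover cb (hinv h x).
have := sh q _ Tq qx; rewrite hinvK => qx'.
by rewrite -(sector_inj cb Tq Tp qx' px).
Qed.

(** Such a map is the product of its restrictions to the finitely many sectors. Each restriction
    fixes [p], the only point of [T] in its sector, so [bounded_psector] applies to it. *)
Lemma bounded_sector_stable E : scale E -> exists K, forall h, sector_stable h -> E K h.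
Proof.
move=> sE; have := finiteT cb => /finite_seqP[s sT].
suff [K EK] : exists K, forall h, sector_stable h ->
    (forall p x, T p -> p \notin s -> sector p x -> h x = x) -> E K h.
  by exists K => h sh; apply: EK => // p x; rewrite sT /= => ->.
have : forall p, p \in s -> T p by move=> p; rewrite sT.
elim: s {sT} => [_|p s IH sT].
  have [K EK] := scaleT sE (haut1 X); exists K => h sh hid.
  suff -> : h = haut1 X by [].
  by apply: haut_eq => x; have [p Tp px] := sector_cover cb x; exact: hid px.
have [|K EK] := IH; first by move=> q qs; apply: sT; rewrite inE qs orbT.
have Tp : T p by apply: sT; rewrite mem_head.
have [L EL] := bounded_psector Tp sE.
exists (L + K)%N => h sh hid.
have [op cp] := sector_clopen cb Tp.
have ph : phomeo (sector p) (sector p) h (hinv h).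
  split=> //; [by move=> x; exact: sh|by move=> x; exact: (sector_stableV sh)| | | |].
  - by move=> x _; rewrite hfunK.
  - by move=> x _; rewrite hinvK.
  - by move=> x _; exact: hcfun.
  - by move=> x _; exact: hcinv.
have [k [kE kN]] := haut_extend_id (conj op cp) ph.
have kp : k p = p.
  rewrite kE; last exact: sector_refl.
  apply: (sectorT cb) => //; first exact: haut_T.
  by apply: sh => //; exact: sector_refl.
have kst : sector_stable k.
  move=> q x Tq qx; have [px|npx] := pselect (sector p x); last by rewrite kN.
  by rewrite kE//; exact: sh.
have -> : h = hautM k (hautM (hautV k) h) by apply: haut_eq => x /=; rewrite hinvK.
apply: (scaleM sE).
  apply: EL => x npx; have [px|/kN//] := pselect (sector p x).
  by have [->//|xp] := pselect (x = p); case: npx.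
apply: EK => [q x Tq qx|q x Tq qs qx] /=.
  by apply: (sector_stableV kst) => //; exact: sh.
have [qp|qp] := eqVneq q p; first by rewrite qp in qx; rewrite -(kE _ qx) hfunK.
rewrite (hid q)//; last by rewrite inE negb_or qp.
by apply: hinv_fix; apply: kN => px; move/eqP: qp; apply; exact: (sector_inj cb Tq Tp qx px).
Qed.

End Bergman.

(** * Generation of the homeomorphism group *)

Inductive gen (X : topologicalType) (S : set (haut X)) : haut X -> Prop :=
| gen1 : gen S (haut1 X)
| genM s h : S s -> gen S h -> gen S (hautM s h).

Section Gen.
Variables (X : topologicalType) (S : set (haut X)).
Implicit Types h k : haut X.

Lemma gen_in h : S h -> gen S h.
Proof.
move=> Sh; have -> : h = hautM h (haut1 X) by exact: haut_eq.
exact: genM Sh (gen1 S).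
Qed.

Lemma gen_comp h k : gen S h -> gen S k -> gen S (hautM h k).
Proof.
move=> gh gk; elim: gh => [|s h' Ss _ IH].
  by have -> : hautM (haut1 X) k = k by exact: haut_eq.
have -> : hautM (hautM s h') k = hautM s (hautM h' k) by exact: haut_eq.
exact: genM.
Qed.

Lemma gen_inv h : (forall s, S s -> S (hautV s)) -> gen S h -> gen S (hautV h).
Proof.
move=> SV; elim=> [|s h' Ss _ IH].
  by have -> : hautV (haut1 X) = haut1 X; [exact: haut_eq|exact: gen1].
have -> : hautV (hautM s h') = hautM (hautV h') (hautV s) by exact: haut_eq.
by apply: gen_comp => //; exact/gen_in/SV.
Qed.

End Gen.

Section Generation.
Variables (X : topologicalType) (d : Order.disp_t) (W : orderType d) (rk : X -> W).
Variables (Z T : set X) (top : X).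
Hypothesis cb : cb_model rk Z T top.
Local Notation sector := (sector rk T).
Local Notation psector := (psector rk T).
Local Notation psub := (psub rk T).
Local Notation zinf := (zinf Z).
Local Notation cell := (cell Z).
Local Notation sector_stable := (sector_stable rk T).
Implicit Types (A B C : set X) (h k f g s : haut X) (p q t x y z : X).
Let wo := cb_wo cb.

Definition fixes_T h := forall t, T t -> h t = t.

Lemma homeomorphic_fill p q A B : clopen A -> clopen B -> A p -> B q ->
  homeomorphic (A `\ p) (B `\ q) ->
  exists f g : X -> X, phomeo A B f g /\ f p = q.
Proof.
move=> cA cB Ap Bq [f [g ph]].
have [f' [g' [ph' fp _]]] := phomeo_fill (wo_hausdorff wo) (cb_compact cb) cA cB Ap Bq ph.
by exists f', g'.
Qed.

Lemma swap_exists p q : T p -> T q ->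
  exists s, s q = p /\ forall t, T t -> t <> p -> t <> q -> s t = t.
Proof.
move=> Tp Tq; have [<-|pq] := pselect (p = q); first by exists (haut1 X).
have hom := psub_homeo cb Tq Tp (psub_psector cb q) (psub_psector cb p)
  (psector_zinf cb Tq) (psector_zinf cb Tp).
have cp := sector_clopen cb Tp; have cq := sector_clopen cb Tq.
have [f [g [ph fq]]] := homeomorphic_fill cq cp (sector_refl _ _ q) (sector_refl _ _ p) hom.
have dis x : sector q x -> sector p x -> False.
  by move=> qx px; apply: pq; exact: (sector_inj cb Tp Tq px qx).
have [||f' [g' [ph' f'E _]]] := phomeo_setU ph (phomeo_sym ph).
- exact: dis.
- by move=> x px qx; exact: (dis x).
rewrite (setUC (sector p)) in ph'.
have [s [sE sN]] := haut_extend_id (clopenU cq cp) ph'.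
exists s; split.
  rewrite sE; last by left; exact: sector_refl.
  by rewrite f'E//; exact: sector_refl.
move=> t Tt tp tq; apply: sN => -[qt|pt]; first exact/tq/(sectorT cb Tq Tt qt).
exact/tp/(sectorT cb Tp Tt pt).
Qed.

Lemma cell_at z A : Z z -> ~ T z -> open A -> A z -> exists2 C, cell C z & C `<=` A.
Proof.
move=> Zz; rewrite (cb_limit cb) not_limit_pointE => -[U nU UZ] oA Az.
have nAU : nbhs z (A `&` U) by apply: filterI => //; exact: open_nbhs_nbhs.
have unique C : C `<=` A `&` U -> forall x, Z x -> C x -> x = z.
  by move=> sC x Zx /sC[_ Ux]; exact: UZ.
case: (rk_nbhs wo nAU) => [[y yz yU]|zU].
  have sC : [set x | rk y < rk x] `&` [set x | rk x <= rk z] `<=` A `&` U.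
    by move=> x [/= yx xz]; exact: yU.
  exists ([set x | rk y < rk x] `&` [set x | rk x <= rk z]); last by move=> x /sC[].
  split=> //; [|by split=> /=|exact: unique].
  by apply: clopenI; [exact: rk_gt_clopen|exact: rk_le_clopen].
have sC : [set x | rk x <= rk z] `<=` A `&` U by move=> x /= xz; exact: zU.
exists [set x | rk x <= rk z]; last by move=> x /sC[].
split=> //=; [exact: rk_le_clopen|exact: unique].
Qed.

Lemma cell_exists p : T p -> exists C c, cell C c /\ C `<=` psector p.
Proof.
move=> Tp; have [c [Zc pc]] := infinite_setN0 (psector_zinf cb Tp).
have [C cC sC] := cell_at Zc (psectorNT cb Tp pc) (psector_open cb p) pc.
by exists C, c.
Qed.

Lemma cell_zinf p C c : T p -> cell C c -> zinf (psector p `\` C).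
Proof.
move=> Tp [_ Cc Zc zC].
have : zinf (C `|` (psector p `\` C)).
  apply: zinfS (psector_zinf cb Tp) => x px.
  by have [Cx|nCx] := pselect (C x); [left|right].
case/zinfU => // -[]; apply: (@sub_finite_set _ _ [set c]); last exact: finite_set1.
by move=> x [Zx Cx]; exact: zC.
Qed.

(** Losing one point of [Z] out of infinitely many does not change the homeomorphism type of the
    punctured sector. *)
Lemma sector_remove p C c : T p -> cell C c -> C `<=` psector p ->
  exists f g : X -> X, phomeo (sector p `\` C) (sector p) f g /\ f p = p.
Proof.
move=> Tp cC sC; have [clC Cc Zc zC] := cC.
have cp := sector_clopen cb Tp.
apply: homeomorphic_fill => //.
- by case: cp clC => [op clp] [oC clC]; split; rewrite setDE; [apply: openI|apply: closedI] => //;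
    [exact: closed_openC|exact: open_closedC].
- by split; [exact: sector_refl|move=> /sC[_]; apply].
have -> : (sector p `\` C) `\ p = psector p `\` C.
  by apply/seteqP; split=> x [[? ?] ?]; split.
have rC := psub_clopen cb clC sC.
apply: (psub_homeo cb Tp Tp (psubD cb (psub_psector cb p) rC) (psub_psector cb p)).
  exact: (cell_zinf Tp cC).
exact: (psector_zinf cb Tp).
Qed.

Definition moves_only p h := forall x, ~ sector p x -> ~ sector top x -> h x = x.

Definition is_shift p s := exists C c, [/\ cell C c, C `<=` psector p,
  forall x, sector p (s x) <-> sector p x /\ ~ C x, fixes_T s & moves_only p s].

Lemma shift_exists p : T p -> p <> top -> exists s, is_shift p s.
Proof.
move=> Tp ptop; have Tt := cb_top cb.
have [C [c [cC sC]]] := cell_exists Tp.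
have [C' [c' [cC' sC']]] := cell_exists Tt.
(* Three pieces are glued: [fa] spreads the sector without [C] over the sector of [p], [fb] carries
   [C] to [C'], and [fc] squeezes the sector of [top] to make room for [C']. *)
have [fa [ga [pha fap]]] := sector_remove Tp cC sC.
have [gc [fc [phc' gct]]] := sector_remove Tt cC' sC'.
have phc := phomeo_sym phc'.
have fct : fc top = top.
  rewrite -{1}gct; apply: (ph_funK phc'); split; first exact: sector_refl.
  by move=> /sC'[_]; apply.
have [fb [gb phb]] := cell_homeo cb cC cC'.
have dis x : sector p x -> sector top x -> False.
  by move=> px tx; apply: ptop; exact: (sector_inj cb Tp Tt px tx).
have [|x Cx [_ /(_ Cx)//]|f1 [g1 [ph1 f1b f1c]]] := phomeo_setU phb phc.
  by move=> x /sC[px _]; exact: dis.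
have E1 : C' `|` (sector top `\` C') = sector top.
  by apply: setDUK => x /sC'[].
rewrite E1 in ph1.
have [x [px nC] [Cx|tx]//||f2 [g2 [ph2 f2a f21]]] := phomeo_setU pha ph1.
- exact: dis px tx.
- exact: dis.
have E2 : (sector p `\` C) `|` (C `|` sector top) = sector p `|` sector top.
  rewrite setUA; congr (_ `|` _); rewrite setUC; apply: setDUK => x /sC[] //.
rewrite E2 in ph2.
have [s [sE sN]] := haut_extend_id (clopenU (sector_clopen cb Tp) (sector_clopen cb Tt)) ph2.
have sa x : sector p x -> ~ C x -> s x = fa x.
  by move=> px nC; rewrite sE; [apply: f2a|left].
have s1 x : (C `|` sector top) x -> s x = f1 x.
  move=> Cx; rewrite sE; first exact: f21.
  by case: Cx => [/sC[]|]; [left|right].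
have nCp : ~ C p by move=> /sC[_]; apply.
exists s, C, c; split=> //.
- move=> x; split; last by move=> [px nC]; rewrite sa//; apply: (ph_fun pha).
  have [Cx|nCx] := pselect ((C `|` sector top) x).
    by rewrite s1// => psx; case: (dis _ psx); exact: (ph_fun ph1).
  have [px _|npx] := pselect (sector p x).
    by split=> // Cx; apply: nCx; left.
  by rewrite sN // => -[//|tx]; apply: nCx; right.
- move=> t Tt'; have [->|tp] := pselect (t = p); first by rewrite sa//; exact: sector_refl.
  have [->|ttop] := pselect (t = top).
    by rewrite s1; [rewrite f1c//; exact: sector_refl|right; exact: sector_refl].
  apply: sN => -[pt|tt]; first exact/tp/(sectorT cb Tp Tt' pt).
  exact/ttop/(sectorT cb Tt Tt' tt).
- by move=> x npx ntx; apply: sN => -[].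
Qed.

Variables (swap : X -> X -> haut X) (shift : X -> haut X).
Hypothesis swapP : forall p q, T p -> T q ->
  swap p q q = p /\ forall t, T t -> t <> p -> t <> q -> swap p q t = t.
Hypothesis shiftP : forall p, T p -> p <> top -> is_shift p (shift p).

Definition generators : set (haut X) := [set h | [\/ sector_stable h,
  exists p q, [/\ T p, T q & h = swap p q \/ h = hautV (swap p q)] |
  exists2 p, T p & h = shift p \/ h = hautV (shift p)]].

Lemma generatorsV h : generators h -> generators (hautV h).
Proof.
have VV k : hautV (hautV k) = k by exact: haut_eq.
case=> [sh|[p [q [Tp Tq]]]|[p Tp]].
- by apply: Or31; exact: (sector_stableV cb sh).
- by move=> [->|->]; apply: Or32; exists p, q; split=> //; rewrite ?VV; [right|left].
- by move=> [->|->]; apply: Or33; exists p => //; rewrite ?VV; [right|left].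
Qed.

Local Notation gen := (gen generators).

(** For [A] inside the sector, [g] stretches [A] to the whole sector of [p] and expels the rest of
    it into the sector of [top]. *)
Definition expands p A g := [/\ gen g, forall x, sector p (g x) <-> A x, fixes_T g & moves_only p g].

(** A sector-preserving [h] first moves the cell to be expelled onto the very cell that the fixed
    shift of [p] expels. *)
Lemma expand_cell p A z : T p -> p <> top -> clopen A -> A p -> A `<=` sector p ->
  cell (sector p `\` A) z -> exists g, expands p A g.
Proof.
move=> Tp ptop clA Ap sA cD; have [C [c [cC sC sec fixs only]]] := shiftP Tp ptop.
have rY := psub_psector cb p.
set D := sector p `\` A in cD.
have sD : D `<=` psector p by move=> x [px nA]; split=> // /= xp; rewrite xp in nA.
have [clD Dz _ _] := cD; have [clC _ _ _] := cC.
have [f [g ph]] := cell_homeo cb cD cC.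
have rD := psub_clopen cb clD sD; have rC := psub_clopen cb clC sC.
have [h [hE sh]] := psub_haut_extend cb Tp rY sD sC ph (psub_homeo cb Tp Tp (psubD cb rY rD)
  (psubD cb rY rC) (cell_zinf Tp cD) (cell_zinf Tp cC)).
have hDC x : C (h x) <-> D x.
  split=> [Chx|Dx]; last by rewrite hE//; exact: (ph_fun ph).
  have Dg := ph_inv ph Chx.
  have : h (g (h x)) = h x by rewrite hE//; exact: (ph_invK ph).
  by move=> /(can_inj (@hfunK _ h)) <-.
have stab : sector_stable h.
  move=> q x Tq qx; have [px|npx] := pselect (psector p x); last by rewrite sh.
  rewrite (sector_inj cb Tq Tp qx (proj1 px)).
  by have [] := supported_stable sh px.
have hp x : sector p (h x) <-> sector p x.
  split; last exact: stab.
  by move=> /(sector_stableV cb stab Tp); rewrite /= hfunK.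
exists (hautM (shift p) h); split.
- apply: gen_comp; apply: gen_in; last by apply: Or31.
  by apply: Or33; exists p => //; left.
- move=> x /=; rewrite sec hp hDC; split; last by move=> Ax; split; [exact: sA|case].
  by move=> [px nD]; apply: contrapT => nA; apply: nD.
- move=> t Tt /=; rewrite sh; first exact: fixs.
  by move=> /(psectorNT cb Tp).
- by move=> x npx ntx /=; rewrite sh ?only// => -[].
Qed.

(** As a neighbourhood of [p], [A] misses only finitely many points of [Z] in the sector; cells
    around them are expelled one at a time. *)
Lemma expand p A z : T p -> p <> top -> clopen A -> A p -> A `<=` sector p ->
  Z z -> sector p z -> ~ A z -> exists g, expands p A g.
Proof.
move=> Tp ptop clA Ap sA Zz pz nAz.
have [s sP] : exists s : seq X, forall x, Z x -> sector p x -> ~ A x -> x \in s.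
  have fin : finite_set (Z `&` (sector p `\` A)).
    have := rk_nbhs wo (open_nbhs_nbhs (conj (proj1 clA) Ap)).
    case=> [[y yp yA]|pA].
      apply: sub_finite_set (sector_finite cb Tp yp) => x [Zx [px nA]].
      split=> //=; rewrite leNgt; apply/negP => yx; apply: nA.
      by apply: yA => //; case: px.
    apply: (@sub_finite_set _ _ set0); last exact: finite_set0.
    by move=> x [Zx [px nA]]; apply: nA; apply: pA; case: px.
  move: fin => /finite_seqP[s sE]; exists s => x Zx px nA.
  by have : [set` s] x by rewrite -sE.
elim: {s}_.+1 {-2}s (ltnSn (size s)) => // n IH s sn in A z clA Ap sA Zz pz nAz sP *.
have oD : open (sector p `\` A).
  by rewrite setDE; apply: openI; [exact: (sector_open cb)|apply: closed_openC; case: clA].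
have nTz : ~ T z by move=> Tz; apply: nAz; rewrite (sectorT cb Tp Tz pz).
(* The induction ends at one missing point, not at none: the difference is then itself a cell, so
   any remaining part free of [Z] leaves together with that point. *)
have [uniq|] := pselect (forall x, Z x -> (sector p `\` A) x -> x = z).
  apply: (expand_cell (z := z) Tp ptop clA Ap sA); split=> //; split=> //.
  by rewrite setDE; apply: closedI; [have [] := sector_clopen cb Tp|apply: open_closedC; case: clA].
move=> /existsNP[z' /not_implyP[Zz' /not_implyP[[pz' nAz'] z'z]]].
have [D cD sD] := cell_at Zz nTz oD (conj pz nAz).
have [clD Dz _ zD] := cD.
have DE : sector p `\` (sector p `\` D) = D by rewrite setDD; apply/setIidr => x /sD[].
have [||||g1 [gen1 sec1 fix1 only1]] := @expand_cell p (sector p `\` D) z Tp ptop.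
- by split; rewrite setDE; [apply: openI; [exact: (sector_open cb)|apply: closed_openC; case: clD]
    |apply: closedI; [have [] := sector_clopen cb Tp|apply: open_closedC; case: clD]].
- by split; [exact: sector_refl|move=> /sD[]].
- by move=> x [].
- by rewrite DE.
pose A1 := hinv g1 @^-1` A.
have inA1 x : A1 (g1 x) <-> A x by rewrite /A1 /preimage /= hfunK.
have surj y : exists x, y = g1 x by exists (hinv g1 y); rewrite hinvK.
have sA1 : A1 `<=` sector p.
  move=> y; have [x ->] := surj y; move=> /inA1 Ax; apply/sec1; split; first exact: sA.
  by move=> /sD[].
have sz : (size [seq g1 x | x <- s & x != z] < n)%N.
  rewrite size_map size_filter; apply: leq_trans (ltnSE sn).
  rewrite -(count_predC (pred1 z)) -add1n leq_add2r -has_count has_pred1.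
  exact: sP.
have [|||||||g2 [gen2 sec2 fix2 only2]] := IH _ sz A1 (g1 z').
- by split; [apply: open_comp|apply: closed_comp] => [x _||x _|]; try exact: hcinv; case: clA.
- by rewrite -(fix1 _ Tp); apply/inA1.
- exact: sA1.
- exact: (haut_Z cb).
- by apply/sec1; split=> // /(zD _ Zz').
- by rewrite inA1.
- move=> y; have [x ->] := surj y; move=> Zgx /sec1[px nD]; rewrite inA1 => nA.
  have Zx : Z x by have := haut_Z cb (hautV g1) Zgx; rewrite /= hfunK.
  apply: map_f; rewrite mem_filter sP// andbT; apply/eqP => xz.
  by apply: nD; rewrite xz.
exists (hautM g2 g1); split.
- exact: gen_comp.
- by move=> x /=; rewrite sec2 inA1.
- by move=> t Tt /=; rewrite fix1 ?fix2.
- by move=> x npx ntx /=; rewrite only1 ?only2.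
Qed.

Lemma moves_only_sector p q h x : T p -> T q -> q <> p -> q <> top -> moves_only p h ->
  sector q (h x) <-> sector q x.
Proof.
move=> Tp Tq qp qt only.
have fix_ y : sector q y -> h y = y.
  move=> qy; apply: only => [py|ty].
    exact/qp/(sector_inj cb Tq Tp qy py).
  exact/qt/(sector_inj cb Tq (cb_top cb) qy ty).
split=> [qhx|qx]; last by rewrite fix_.
by have := fix_ _ qhx => /(can_inj (@hfunK _ h)) <-.
Qed.

(** [f] maps [A] onto [A']; stretching both to the sector of [p], by [g] and [g'], makes [g' f g^-1]
    preserve that sector. Only the sectors of [p] and [top] are disturbed, so the list [l] of
    sectors that may fail to be preserved shrinks. *)
Lemma gen_fixes_T f : fixes_T f -> gen f.
Proof.
have := finiteT cb => /finite_seqP[l lT] fixf.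
have : forall q x, T q -> q \notin l -> q <> top -> (sector q (f x) <-> sector q x).
  by move=> q x; rewrite lT /= => ->.
elim: l {lT} => [|p l IH] in f fixf * => fl.
  apply: gen_in; apply: Or31 => p x Tp px.
  (* When all other sectors are preserved, so is that of [top], their complement. *)
  have [pt|pt] := pselect (p = top); last by apply/fl.
  have [q Tq qx] := sector_cover cb (f x).
  have [qt|qt] := pselect (q = top); first by rewrite pt -qt.
  have := qx; rewrite fl// => qx'.
  by rewrite (sector_inj cb Tp Tq px qx').
have [[Tp ptop]|np] := pselect (T p /\ p <> top); last first.
  apply: IH => // q x Tq ql qt; apply: fl => //; rewrite inE negb_or ql andbT.
  by apply/eqP => qp; apply: np; rewrite -qp.
have [b [Zb pb]] := infinite_setN0 (psector_zinf cb Tp).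
(* Cutting above [b] leaves a point of [Z] in the sector outside both [A] and [A'], as [expand]
   requires. *)
pose N := sector p `&` [set x | rk b < rk x].
have clN : clopen N by apply: clopenI; [exact: (sector_clopen cb)|exact: rk_gt_clopen].
pose A := N `&` f @^-1` N.
have Np : N p by split; [exact: sector_refl|exact: (psector_lt cb pb)].
have clA : clopen A.
  apply: clopenI => //; case: clN => oN cN.
  by split; [apply: open_comp|apply: closed_comp] => // x _; exact: hcfun.
have Ap : A p by split=> //; rewrite /preimage /= fixf.
pose A' := hinv f @^-1` A.
have clA' : clopen A'.
  case: clA => oA cA.
  by split; [apply: open_comp|apply: closed_comp] => // x _; exact: hcinv.
have [g [geng secg fixg onlyg]] : exists g, expands p A g.
  apply: (expand (z := b) Tp ptop clA) => //; first by move=> x [[]].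
    by case: pb.
  by move=> [[_ /=]]; rewrite ltxx.
have [g' [geng' secg' fixg' onlyg']] : exists g, expands p A' g.
  apply: (expand (z := b) Tp ptop clA') => //.
  - by rewrite /A' /preimage /= hinv_fix//; exact: fixf.
  - by move=> x [_ []]; rewrite /preimage /= hinvK.
  - by case: pb.
  - by move=> [_ [_]]; rewrite /= hinvK ltxx.
have -> : f = hautM (hautV g') (hautM (hautM g' (hautM f (hautV g))) g).
  by apply: haut_eq => x /=; rewrite !hfunK.
apply: gen_comp; first by apply: gen_inv => //; exact: generatorsV.
apply: gen_comp => //; apply: IH => [t Tt|q x Tq ql qt] /=.
  by rewrite (hinv_fix (fixg _ Tt)) fixf// fixg'.
have [->|qp] := pselect (q = p).
  rewrite secg' /A' /preimage /= hfunK -secg hinvK; exact: iff_refl.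
rewrite (moves_only_sector _ Tp Tq qp qt onlyg') fl//; last first.
  by rewrite inE negb_or ql andbT; exact/eqP.
by rewrite -(moves_only_sector _ Tp Tq qp qt onlyg) hinvK; exact: iff_refl.
Qed.

(** Applied after [f], the swap of [p] and [f p] returns [p] to its place. A point of [T] other than
    [p] that [f] fixes also differs from [f p] and stays fixed, so the list [l] of points that may
    move shrinks. *)
Lemma gen_haut f : gen f.
Proof.
have := finiteT cb => /finite_seqP[l lT].
have : forall t, T t -> t \notin l -> f t = t by move=> t; rewrite lT /= => ->.
elim: l {lT} => [|p l IH] in f * => fl.
  by apply: gen_fixes_T => t Tt; exact: fl.
have [Tp|nTp] := pselect (T p); last first.
  apply: IH => t Tt tl; apply: fl => //; rewrite inE negb_or tl andbT.
  by apply/eqP => tp; apply: nTp; rewrite -tp.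
have Tq := haut_T cb f Tp; have [sq st] := swapP Tp Tq.
have -> : f = hautM (hautV (swap p (f p))) (hautM (swap p (f p)) f).
  by apply: haut_eq => x /=; rewrite hfunK.
apply: gen_comp.
  by apply: gen_in; apply: Or32; exists p, (f p); split=> //; right.
apply: IH => t Tt tl /=; have [->//|tp] := pselect (t = p).
have ft : f t = t by apply: fl => //; rewrite inE negb_or tl andbT; exact/eqP.
rewrite ft; apply: st => // tq; apply: tp.
by apply: (can_inj (@hfunK _ f)); rewrite ft.
Qed.

Lemma seq_bound (P : X -> nat -> Prop) (l : seq X) :
  (forall x m n, (m <= n)%N -> P x m -> P x n) -> (forall x, exists n, P x n) ->
  exists n, forall x, x \in l -> P x n.
Proof.
move=> mono ex; elim: l => [|x l [n IH]]; first by exists 0%N.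
have [m Pm] := ex x; exists (m + n)%N => y; rewrite inE => /orP[/eqP ->|/IH].
  by apply: mono Pm; exact: leq_addr.
by apply: mono; exact: leq_addl.
Qed.

Lemma generators_bounded E : scale E -> exists K, forall h, generators h -> E K h.
Proof.
move=> sE; have [K0 EK0] := bounded_sector_stable cb sE.
have := finiteT cb => /finite_seqP[l lT].
have inl x : T x -> x \in l by rewrite lT.
have [|x|K1 EK1] := @seq_bound (fun p n => forall q, q \in l -> E n (swap p q)) l.
- by move=> x m n mn H q /H; exact: scaleW.
- apply: (seq_bound (P := fun q n => E n (swap x q))) => [y m n mn|y]; first exact: scaleW.
  exact: scaleT.
have [|x|K2 EK2] := @seq_bound (fun p n => E n (shift p)) l.
- by move=> x m n mn; exact: scaleW.
- exact: scaleT.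
exists (K0 + (K1 + K2))%N => h; case=> [/EK0|[p [q [Tp Tq]]]|[p Tp]].
- by apply: (scaleW sE); exact: leq_addr.
- have H : E (K0 + (K1 + K2))%N (swap p q).
    apply: scaleW (EK1 _ (inl _ Tp) _ (inl _ Tq)) => //.
    by rewrite addnCA leq_addr.
  by case=> ->//; exact: scaleV.
- have H : E (K0 + (K1 + K2))%N (shift p).
    by apply: scaleW (EK2 _ (inl _ Tp)) => //; rewrite addnA leq_addl.
  by case=> ->//; exact: scaleV.
Qed.

End Generation.

Lemma cb_model_generators (X : topologicalType) (d : Order.disp_t) (W : orderType d) (rk : X -> W)
    (Z T : set X) (top : X) : cb_model rk Z T top ->
  exists S : set (haut X), (forall h, gen S h) /\
    forall E, scale E -> exists K, forall h, S h -> E K h.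
Proof.
move=> cb.
have /choice[swap swapP] : forall p, exists s : X -> haut X, forall q, T p -> T q ->
    s q q = p /\ forall t, T t -> t <> p -> t <> q -> s q t = t.
  move=> p; suff /choice[s sP] : forall q, exists s : haut X, T p -> T q ->
      s q = p /\ forall t, T t -> t <> p -> t <> q -> s t = t by exists s.
  move=> q.
  have [[Tp Tq]|nT] := pselect (T p /\ T q); last by exists (haut1 X) => Tp Tq; case: nT.
  by have [s sP] := swap_exists cb Tp Tq; exists s.
have /choice[shift shiftP] : forall p, exists s, T p -> p <> top -> is_shift rk Z T top p s.
  move=> p; have [[Tp pt]|nT] := pselect (T p /\ p <> top).
    by have [s sP] := shift_exists cb Tp pt; exists s.
  by exists (haut1 X) => Tp pt; case: nT.
exists (generators rk T swap shift); split; first exact: (gen_haut cb swapP shiftP).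
exact: generators_bounded cb _ _.
Qed.

(** * Cantor-Bendixson derivatives *)

Section Hierarchy.
Variables (dW : Order.disp_t) (W : orderType dW).
Hypothesis woW : well_ordered W.

Lemma well_ordered_ind (P : W -> Prop) :
  (forall w, (forall v, v < w -> P v) -> P w) -> forall w, P w.
Proof.
move=> IH w; apply: contrapT => nP.
have [|m [nm lm]] := woW (A := [set w | ~ P w]); first by exists w.
apply: nm; apply: IH => v vm; apply: contrapT => /lm.
by rewrite leNgt vm.
Qed.

Lemma zero_succ_limit (w : W) :
  [\/ forall v, ~ v < w, exists v, is_succ v w | is_limit w].
Proof.
have [ex|nex] := pselect (exists v, v < w); last first.
  by apply: Or31 => v vw; apply: nex; exists v.
have [s|ns] := pselect (exists v, is_succ v w); first exact: Or32.
exact: Or33.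
Qed.

Variables (X : topologicalType) (D : W -> set X).
Hypothesis hD : CB_hierarchy D.

Lemma derivative_closed w : accessible_space X -> closed (D w).
Proof.
move=> aX; have [D0 DS Dl] := hD; elim/well_ordered_ind: w => w IH.
case: (zero_succ_limit w) => [/D0 ->|[v /DS ->]|lw].
- exact: closedT.
- exact: limit_point_closed.
- by rewrite Dl//; apply: closed_bigI => v /= vw; exact: IH.
Qed.

(** Being a limit point is a local property, so homeomorphisms between open sets already respect
    every derivative. *)
Lemma derivative_invariant w A B f g x : phomeo A B f g -> A x -> D w x -> D w (f x).
Proof.
have [D0 DS Dl] := hD => ph; elim/well_ordered_ind: w x => w IH x Ax.
case: (zero_succ_limit w) => [/D0 ->//|[v vw]|lw]; last first.
  by rewrite Dl// => Dx v /= vw; apply: IH => //; exact: Dx.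
rewrite (DS _ _ vw) => lx U /(ph_cfun ph Ax) nU.
have {}nU : nbhs x (f @^-1` U) by [].
have nA : nbhs x A by apply: open_nbhs_nbhs; split=> //; exact: ph_openl ph.
have [y [yx Dy [Uy Ay]]] := lx _ (filterI nU nA).
exists (f y); split=> //; last by apply: IH => //; case: vw.
by apply: contra_neq yx => E; rewrite -(ph_funK ph Ay) E (ph_funK ph Ax).
Qed.

End Hierarchy.

(** * Compact well-ordered spaces and the change of order *)

Section OrderTopology.
Variables (d : Order.disp_t) (X : orderTopologicalType d).
Hypothesis woX : well_ordered X.
Hypothesis cX : compact [set: X].
Implicit Types x y z m : X.

Lemma ray_le_open x : open [set y : X | y <= x].
Proof.
have [[z xz]|nz] := pselect (exists z, x < z).
  (* The immediate successor [s] of [x] turns the closed ray into an open one. *)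
  have [|s [xs ls]] := woX (A := [set z | x < z]); first by exists z.
  have -> : [set y : X | y <= x] = `]-oo, s[%classic; last exact: lray_open.
  apply/seteqP; split=> y /=; rewrite in_itv /=; first by move/le_lt_trans; apply.
  by apply: contraTT; rewrite -ltNge -leNgt => /ls.
have -> : [set y : X | y <= x] = setT; last exact: openT.
by apply/seteqP; split=> y //= _; rewrite leNgt; apply/negP => xy; apply: nz; exists y.
Qed.

Lemma ray_gt_open x : open [set y : X | x < y].
Proof.
have -> : [set y : X | x < y] = `]x, +oo[%classic; last exact: rray_open.
by apply/seteqP; split=> y /=; rewrite in_itv /= andbT.
Qed.

Lemma nbhs_left x U : nbhs x U ->
  (exists2 y, y < x & forall z, y < z -> z <= x -> U z) \/ (forall z, z <= x -> U z).
Proof.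
rewrite itv_nbhsE => -[[l r] [oi xi] iU].
have sub z : (l <= BLeft z)%O -> z <= x -> U z.
  move=> lz zx; apply: iU; move: xi; rewrite /= !itv_boundlr => /andP[_ xr].
  by rewrite lz /=; apply: le_trans xr; rewrite bnd_simp.
case: l => [b a|[]] in oi xi sub {iU} *; last first.
- by move: xi; rewrite itv_boundlr.
- by right=> z; apply: sub.
case: b in oi xi sub *; first by case: r oi {xi sub} => [[]?|[]] [].
left; exists a; first by move: xi; rewrite itv_boundlr => /andP[].
by move=> z az; apply: sub; rewrite bnd_simp.
Qed.

Lemma wo_space_id : wo_space (id : X -> X).
Proof.
split=> //.
- by move=> A /woX[x [Ax lx]]; exists x.
- exact: ray_le_open.
- exact: ray_gt_open.
- exact: nbhs_left.
Qed.

(** Without a maximum the tails would generate a proper filter, and no [y] is a cluster point of it: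
    the open ray up to [y] misses the tail after [y]. *)
Lemma compact_max x : exists m, forall z, z <= m.
Proof.
apply: contrapT => nmax.
have tail y : [set z : X | y < z] !=set0.
  apply: contrapT => ny; apply: nmax; exists y => z; rewrite leNgt; apply/negP => yz.
  by apply: ny; exists z.
pose F := filter_from [set: X] (fun y => [set z | y < z]).
have FF : ProperFilter F.
  apply: filter_from_proper => //; apply: filter_from_filter; first by exists x.
  move=> y z _ _; exists (Order.max y z) => // w /=.
  by rewrite gt_max => /andP[].
have [|y [_ cl]] := cX FF; first by exists x.
have [||z [/= yz zy]] := cl [set z | y < z] [set z | z <= y].
- by exists y.
- by apply: open_nbhs_nbhs; split=> //=; exact: ray_le_open.
- by move: yz; rewrite ltNge zy.
Qed.

(* Moving the points above [m] to the front keeps the topology and makes [m] the maximum. *)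
Definition rotate m x : bool *l X := (x <= m, x).

Lemma rotate_le m x y :
  (rotate m y <= rotate m x) = if x <= m then (y <= m) ==> (y <= x) else ~~ (y <= m) && (y <= x).
Proof.
rewrite /rotate lexi_pair; case: (x <= m); case: (y <= m) => //=.
Qed.

Lemma wo_space_rotate m : wo_space (rotate m).
Proof.
have lem z : (m < z) = ~~ (z <= m) by rewrite ltNge.
have ltE x y : (rotate m x < rotate m y) = ~~ (rotate m y <= rotate m x) by rewrite ltNge.
have [M MP] := compact_max m.
split.
- by move=> x y [].
- move=> A [a Aa].
  have [[b [Ab mb]]|nb] := pselect (exists b, A b /\ m < b).
    have [|x [[Ax mx] lx]] := woX (A := [set x | A x /\ m < x]); first by exists b.
    exists x => // y Ay; rewrite rotate_le; case: (leP y m) => /= [ym|my].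
      by rewrite leNgt mx.
    by rewrite -lem mx; exact: lx.
  have [|x [Ax lx]] := woX (A := A); first by exists a.
  exists x => // y Ay; rewrite rotate_le; have -> : y <= m.
    by rewrite leNgt; apply/negP => my; apply: nb; exists y.
  by rewrite (lx y Ay) implybT.
- move=> x; have [xm|mx] := leP x m.
    have -> : [set y | rotate m y <= rotate m x] = [set y | m < y] `|` [set y | y <= x].
      by apply/seteqP; split=> y /=; rewrite rotate_le xm lem; case: (y <= m) => //=; auto; case.
    by apply: openU; [exact: ray_gt_open|exact: ray_le_open].
  have -> : [set y | rotate m y <= rotate m x] = [set y | m < y] `&` [set y | y <= x].
    by apply/seteqP; split=> y /=; rewrite rotate_le (lt_geF mx) /= -lem => /andP.
  by apply: openI; [exact: ray_gt_open|exact: ray_le_open].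
- move=> x; have [xm|mx] := leP x m.
    have -> : [set y | rotate m x < rotate m y] = [set y | x < y] `&` [set y | y <= m].
      apply/seteqP; split=> y /=; rewrite ltE rotate_le; case: (y <= m) => //=; rewrite ?xm /= ltNge //.
      by case.
      by case.
    by apply: openI; [exact: ray_gt_open|exact: ray_le_open].
  have -> : [set y | rotate m x < rotate m y] = [set y | y <= m] `|` [set y | x < y].
    apply/seteqP; split=> y /=; rewrite ltE rotate_le ltNge; case: (y <= m) => //=;
      rewrite (lt_geF mx) //=; auto.
    by case.
  by apply: openU; [exact: ray_le_open|exact: ray_gt_open].
- move=> x U /nbhs_left nU; have [xm|mx] := leP x m.
    case: nU => [[y yx yU]|xU].
      left; exists y; first by rewrite ltE rotate_le (le_trans (ltW yx) xm) xm /= -ltNge.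
      move=> z; rewrite ltE !rotate_le xm (le_trans (ltW yx) xm).
      by case: (z <= m) => //= yz zx; apply: yU => //; rewrite ltNge.
    (* In the new order the points after [m] precede [x]. The old maximum [M] is the last of them
       and serves as left bound, unless [m] is itself the maximum. *)
    have [Mm|mM] := leP M m.
      right=> z; rewrite rotate_le xm (le_trans (MP z) Mm) /=; exact: xU.
    left; exists M; first by rewrite ltE rotate_le xm (lt_geF mM).
    move=> z; rewrite ltE !rotate_le xm (lt_geF mM) /=.
    by case: (z <= m) => /=; [move=> _; exact: xU|rewrite MP].
  case: nU => [[y yx yU]|xU]; last first.
    by right=> z; rewrite rotate_le (lt_geF mx) /= => /andP[_]; exact: xU.
  (* A left bound at or before [m] disappears, since the points after [m] now come first. *)
  have [ym|my] := leP y m.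
    right=> z; rewrite rotate_le (lt_geF mx) /= -lem => /andP[mz zx].
    by apply: yU => //; exact: le_lt_trans ym mz.
  left; exists y; first by rewrite ltE rotate_le (lt_geF mx) (lt_geF my) /= -ltNge.
  move=> z; rewrite ltE !rotate_le (lt_geF mx) (lt_geF my) /=.
  by move=> + /andP[nz zx]; rewrite (negbTE nz) /= -ltNge => yz; exact: yU.
Qed.

Lemma rotate_max m x : rotate m x <= rotate m m.
Proof. by rewrite rotate_le lexx implybb. Qed.

Lemma cb_model_exists : limit_capacity_is_successor X ->
  exists Z T m, cb_model (rotate m) Z T m.
Proof.
move=> [dW [W [D [g0 [g1 [g2 [woW hD s01 s12 [[r1 [s2 D2]] nD]]]]]]]].
have [_ DS _] := hD.
have wid := wo_space_id.
have aX : accessible_space X := hausdorff_accessible (wo_hausdorff wid).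
(* The hierarchy can stabilize only at the empty set: the open ray up to the least point of a
   nonempty [D g2] isolates that point, which would then be missing from [D r1]. *)
have D20 x : ~ D g2 x.
  move=> Dx; have [|m [Dm lm]] := woX (A := D g2); first by exists x.
  have : D r1 m by rewrite D2.
  rewrite (DS _ _ s2) => /(_ [set y | y <= m]) [|y [ym Dy /= yle]].
    by apply: open_nbhs_nbhs; split=> //=; exact: ray_le_open.
  by move/negP: ym; apply; rewrite eq_le yle lm.
(* Otherwise the hierarchy would already be stable at [g1], against the minimality of the rank. *)
have [t Tt] : D g1 !=set0.
  apply: contrapT => n1; apply: (nD _ _ s12); first by case: s12.
  by apply/seteqP; split=> x => [/D20//|D1x]; case: n1; exists x.
exists (D g0), (D g1), t; split=> //.
- exact: wo_space_rotate.
- exact: derivative_closed.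
- exact: DS.
- by move=> x; rewrite -(DS _ _ s12); exact: D20.
- by move=> A B f g x; exact: derivative_invariant.
- exact: rotate_max.
Qed.

End OrderTopology.

(** * From left-invariant metrics to lengths *)

Section LengthScale.
Variable X : topologicalType.
Implicit Types h k : haut X.

Lemma haut_homeo h : Homeo X h.
Proof. by exists (hinv h); split; [exact: hfunK|exact: hinvK|exact: hcfun|exact: hcinv]. Qed.

Lemma homeo_haut f : Homeo X f -> exists h : haut X, f = h.
Proof. by move=> [g [fK gK cf cg]]; exists (HAut fK gK cf cg). Qed.

(** Left invariance makes the distance to the identity subadditive and invariant under inversion. *)
Lemma dist_scale dist : left_invariant_metric dist ->
  scale (fun n h => Rle (dist id (h : X -> X)) (INR n)).
Proof.
move=> [d0 dsep dsym dtri dinv].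
have G1 : Homeo X id := haut_homeo (haut1 X).
split.
- move=> m n h k hm kn.
  apply: (Rle_trans _ _ _ (dtri id h (h \o k) G1 (haut_homeo h) (haut_homeo (hautM h k)))).
  rewrite plus_INR; apply: Rplus_le_compat => //.
  by rewrite (dinv id k h G1 (haut_homeo k) (haut_homeo h)).
- move=> n h hn; rewrite -(dinv id _ h G1 (haut_homeo (hautV h)) (haut_homeo h)).
  have -> : h \o hautV h = id by apply/funext => x /=; rewrite hinvK.
  by rewrite dsym//; exact: haut_homeo.
- by move=> m n h mn hm; apply: (Rle_trans _ _ _ hm); apply: le_INR; exact/ssrnat.leP.
- move=> h; have [n hn] := INR_unbounded (dist id h).
  by exists n; exact: Rlt_le.
Qed.

End LengthScale.

Theorem theorem6p1 (d : Order.disp_t) (X : orderTopologicalType d) :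
  well_ordered X ->
  compact [set: X]%classic ->
  limit_capacity_is_successor X ->
  SB_generated_Homeo X.
Proof.
move=> woX cX lc.
have [Z [T [m cb]]] := cb_model_exists woX cX lc.
have [S [genS bS]] := cb_model_generators cb.
exists [set f | exists2 h : haut X, S h & f = h :> (X -> X)]; split.
  split; first by move=> f [h _ ->]; exact: haut_homeo.
  move=> dist dP; have [K SK] := bS _ (dist_scale dP).
  have [_ _ dsym dtri _] := dP.
  have G1 : Homeo X id := haut_homeo (haut1 X).
  exists (Rplus (INR K) (INR K)) => f g [h Sh ->] [k Sk ->].
  apply: (Rle_trans _ _ _ (dtri h id k (haut_homeo h) G1 (haut_homeo k))).
  apply: Rplus_le_compat; last exact: SK.
  by rewrite dsym//; [exact: SK|exact: haut_homeo].
move=> f /homeo_haut[h ->].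
elim: (genS h) => [|s k Ss _ [l [lS lE]]]; first by exists [::].
exists ((s : X -> X) :: l); split; last by rewrite /= -lE.
by move=> f'; rewrite inE => /orP[/eqP ->|/lS//]; left; exists s.
Qed.
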